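(* Let $p$ be a prime and let $G$ be a Demushkin pro-$p$-group of rank $d$ with $d\geq 1$, and let $q=q(G)$ be its $q$-invariant. Let $\mathrm{U}_4(\mathbb{F}_p)$ be the group of upper-triangular unipotent $4\times 4$ matrices over $\mathbb{F}_p$. Then the number of continuous surjective homomorphisms $G\to \mathrm{U}_4(\mathbb{F}_p)$ is \[ |\mathrm{Epi}(G,\mathrm{U}_4(\mathbb{F}_p))|= \begin{cases} (p^{d}-1)(p^{d-1}-p)(p^{d-1}-p^2)p^{3d-1} &\text{ if $q\neq 2$},\\ (2^{d-1}-1)(2^{d-1}-2)(2^{d}-4)2^{3d-1} &\text{ if $q=2$}. \end{cases} \]
   Context: A pro-$p$-group $G$ is a Demushkin group if $\dim_{\mathbb{F}_p}H^1(G,\mathbb{F}_p)<\infty$, $\dim_{\mathbb{F}_p}H^2(G,\mathbb{F}_p)=1$, and the cup product $H^1(G,\mathbb{F}_p)\times H^1(G,\mathbb{F}_p)\to H^2(G,\mathbb{F}_p)$ is a non-degenerate bilinear form (here $\mathbb{F}_p$ is a trivial $G$-module). Its rank is $d=\dim_{\mathbb{F}_p}H^1(G,\mathbb{F}_p)$, the minimal number of topological generators. The $q$-invariant $q(G)$ is the uniquely determined power of $p$ (with the convention $p^\infty=0$) such that $G/[G,G]\cong \mathbb{Z}_p^{d-1}\times \mathbb{Z}_p/q\mathbb{Z}_p$. $\mathrm{Epi}(G,H)$ denotes the set of continuous surjective homomorphisms $G\to H$. *)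

(* Defs.v *)
From HB Require Import structures.
From mathcomp Require Import all_boot all_order all_algebra all_fingroup.
From mathcomp Require Import all_classical topology.

Set Implicit Arguments.
Unset Strict Implicit.
Unset Printing Implicit Defensive.

Import GRing.Theory.

Local Open Scope classical_set_scope.
Local Open Scope card_scope.
Local Open Scope quotient_scope.
Local Open Scope group_scope.

HB.mixin Record Group_isTopologicalGroup G & Topological G & monoid.Group G := {
  mulg_continuous : continuous (fun x : G * G => x.1 * x.2) ;
  invg_continuous : continuous (fun x : G => x^-1) }.

#[short(type="topGroupType")]
HB.structure Definition TopologicalGroup :=
  {G of Group_isTopologicalGroup G & Topological G & monoid.Group G}.

Definition topgroup_iso (G H : topGroupType) : Prop :=
  exists (f : G -> H) (g : H -> G),
    [/\ cancel f g, cancel g f, {morph f : x y / x * y},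
        continuous f & continuous g].

Record subgroup (G : groupType) := Subgroup {
  subgroup_set :> set G ;
  subgroup1 : subgroup_set 1 ;
  subgroupM : forall x y, subgroup_set x -> subgroup_set y ->
    subgroup_set (x * y) ;
  subgroupV : forall x, subgroup_set x -> subgroup_set x^-1 }.

Record normal_subgroup (G : groupType) := NormalSubgroup {
  normal_subgroup_sub :> subgroup G ;
  subgroupJ : forall x y : G, subgroup_set normal_subgroup_sub x ->
    subgroup_set normal_subgroup_sub (x ^ y) }.

Section DiscreteGroup.
Variable G : groupType.
Local Notation D := (discrete_topology G).

HB.instance Definition _ := monoid.Group.copy D G.

Let discrete_mulg_continuous : continuous (fun x : D * D => x.1 * x.2).
Proof.
move=> x; apply/discrete_cvg.
exists ([set x.1], [set x.2]) => /=; first by split; exact: discrete_set1.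
by move=> [a b] [/= -> ->].
Qed.

Let discrete_invg_continuous : continuous (fun x : D => x^-1).
Proof. by apply/continuousP => A _; exact: discrete_open. Qed.

HB.instance Definition _ := Group_isTopologicalGroup.Build D
  discrete_mulg_continuous discrete_invg_continuous.
End DiscreteGroup.

Section PairGroup.
Variables G H : topGroupType.
Local Notation P := (G * H)%type.

Let pair_mulg_continuous : continuous (fun x : P * P => x.1 * x.2).
Proof.
move=> x; apply: cvg_pair => /=.
  apply: (@continuous_comp _ _ _ (fun x : P * P => (x.1.1, x.2.1))
    (fun x : G * G => x.1 * x.2)); last exact: mulg_continuous.
  by apply: cvg_pair; apply: (@continuous_comp _ _ _ _ fst);
    (exact: cvg_fst || exact: cvg_snd).
apply: (@continuous_comp _ _ _ (fun x : P * P => (x.1.2, x.2.2))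
  (fun x : H * H => x.1 * x.2)); last exact: mulg_continuous.
by apply: cvg_pair; apply: (@continuous_comp _ _ _ _ snd);
  (exact: cvg_fst || exact: cvg_snd).
Qed.

Let pair_invg_continuous : continuous (fun x : P => x^-1).
Proof.
move=> x; apply: cvg_pair => /=.
  by apply: (@continuous_comp _ _ _ fst); [exact: cvg_fst|exact: invg_continuous].
by apply: (@continuous_comp _ _ _ snd); [exact: cvg_snd|exact: invg_continuous].
Qed.

HB.instance Definition _ := Group_isTopologicalGroup.Build P
  pair_mulg_continuous pair_invg_continuous.
End PairGroup.

Definition topgroup_prod (I : Type) (G : I -> topGroupType) : Type :=
  prod_topology (fun i => G i : Type).

Section FamilyGroup.
Variables (I : Type) (G : I -> topGroupType).
Local Notation P := (topgroup_prod G).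

HB.instance Definition _ := Topological.on P.

Definition family_one : P := fun=> 1.
Definition family_mul (x y : P) : P := fun i => x i * y i.
Definition family_inv (x : P) : P := fun i => (x i)^-1.

Let family_mulgA : associative family_mul.
Proof. by move=> x y z; apply/functional_extensionality_dep => i; exact: mulgA. Qed.
Let family_mul1g : left_id family_one family_mul.
Proof. by move=> x; apply/functional_extensionality_dep => i; exact: mul1g. Qed.
Let family_mulg1 : right_id family_one family_mul.
Proof. by move=> x; apply/functional_extensionality_dep => i; exact: mulg1. Qed.
Let family_mulVg : left_inverse family_one family_inv family_mul.
Proof. by move=> x; apply/functional_extensionality_dep => i; exact: mulVg. Qed.
Let family_mulgV : right_inverse family_one family_inv family_mul.
Proof. by move=> x; apply/functional_extensionality_dep => i; exact: mulgV. Qed.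

HB.instance Definition _ := isGroup.Build P
  family_mulgA family_mul1g family_mulg1 family_mulVg family_mulgV.


Let family_continuous (T : topologicalType) (f : T -> P) :
  (forall i, continuous (fun t => f t i)) -> continuous f.
Proof.
move=> cf x; apply/cvg_sup => i A; rewrite nbhsE => -[B [[C oC <-] Cfx] sA].
by apply: (filterS sA); apply: (cf i x); exact: open_nbhs_nbhs.
Qed.

Let family_proj_continuous i : continuous (fun x : P => x i).
Proof.
move=> x A; rewrite nbhsE => -[B [oB Bx] sA].
have /cvg_sup/(_ i) cx : nbhs x --> x by exact: cvg_id.
apply: (cx ((fun y : P => y i) @^-1` A)); rewrite nbhsE.
by exists ((fun y : P => y i) @^-1` B) => [|y /sA//]; split=> //; exists B.
Qed.

Let family_mulg_continuous : continuous (fun x : P * P => x.1 * x.2).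
Proof.
apply: family_continuous => i x.
apply: (@continuous_comp _ _ _ (fun x : P * P => (x.1 i, x.2 i))
  (fun x : G i * G i => x.1 * x.2)); last exact: mulg_continuous.
by apply: cvg_pair; apply: (@continuous_comp _ _ _ _ (fun y : P => y i));
  (exact: cvg_fst || exact: cvg_snd || exact: family_proj_continuous).
Qed.

Let family_invg_continuous : continuous (fun x : P => x^-1).
Proof.
apply: family_continuous => i x.
by apply: (@continuous_comp _ _ _ (fun y : P => y i));
  [exact: family_proj_continuous|exact: invg_continuous].
Qed.

HB.instance Definition _ := Group_isTopologicalGroup.Build P
  family_mulg_continuous family_invg_continuous.
End FamilyGroup.

Definition subgroup_type (G : groupType) (H : subgroup G) : Type := set_type H.

Section SubgroupTopology.
Variables (G : topGroupType) (H : subgroup G).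
Local Notation S := (subgroup_type H).

HB.instance Definition _ := Topological.copy S (set_type H).
HB.instance Definition _ := SubChoice.copy S (set_type H).

Let subgroup_closed : group_closed (fun x => x \in (H : set G)).
Proof.
split=> [|x y]; rewrite -!topredE/= !inE; first exact: subgroup1.
by move=> Hx /subgroupV; exact: subgroupM.
Qed.

HB.instance Definition _ :=
  SubChoice_isSubGroup.Build G (fun x => x \in (H : set G)) S subgroup_closed.

Let val_continuous : continuous (val : S -> G).
Proof. exact: initial_continuous. Qed.

Let subgroup_continuous (T : topologicalType) (f : T -> S) :
  continuous (fun t => val (f t)) -> continuous f.
Proof.
by move=> /continuousP cf; apply/continuousP => _ [A oA <-]; exact: cf.
Qed.

Let subgroup_mulg_continuous : continuous (fun x : S * S => x.1 * x.2).
Proof.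
apply: subgroup_continuous => x.
apply: (@continuous_comp _ _ _ (fun x : S * S => (val x.1, val x.2))
  (fun x : G * G => x.1 * x.2)); last exact: mulg_continuous.
by apply: cvg_pair; apply: (@continuous_comp _ _ _ _ (val : S -> G));
  (exact: cvg_fst || exact: cvg_snd || exact: val_continuous).
Qed.

Let subgroup_invg_continuous : continuous (fun x : S => x^-1).
Proof.
apply: subgroup_continuous => x.
by apply: (@continuous_comp _ _ _ (val : S -> G));
  [exact: val_continuous|exact: invg_continuous].
Qed.

HB.instance Definition _ := Group_isTopologicalGroup.Build S
  subgroup_mulg_continuous subgroup_invg_continuous.
End SubgroupTopology.

Section QuotientGroup.
Local Notation repr := generic_quotient.repr.
Variables (G : topGroupType) (N : normal_subgroup G).

Definition coset_rel : rel G := fun x y => `[< (N : set G) (x^-1 * y) >].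

Let coset_rel_refl : reflexive coset_rel.
Proof. by move=> x; apply/asboolP; rewrite mulVg; exact: subgroup1. Qed.
Let coset_rel_sym : symmetric coset_rel.
Proof.
by move=> x y; apply/asboolP/asboolP => /subgroupV; rewrite invgM invgK.
Qed.
Let coset_rel_trans : transitive coset_rel.
Proof.
move=> y x z /asboolP Nxy /asboolP Nyz; apply/asboolP.
by have := subgroupM Nxy Nyz; rewrite mulgA mulgK.
Qed.

Canonical coset_equiv :=
  EquivRel coset_rel coset_rel_refl coset_rel_sym coset_rel_trans.

Definition topgroup_quotient : Type := quotient_topology {eq_quot coset_equiv}.
Local Notation Q := topgroup_quotient.
HB.instance Definition _ := Topological.on Q.
HB.instance Definition _ := Quotient.on Q.

Let pi_eq x y : \pi_Q x = \pi_Q y <-> (N : set G) (x^-1 * y).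
Proof.
by split=> [/eqmodP/asboolP|/asboolP Nxy]; last exact/eqmodP.
Qed.

Let pi_repr x : (N : set G) (x^-1 * repr (\pi_Q x)).
Proof. by apply/pi_eq; rewrite reprK. Qed.

Definition quotient_one : Q := \pi_Q 1.
Definition quotient_mul (a b : Q) : Q := \pi_Q (repr a * repr b).
Definition quotient_inv (a : Q) : Q := \pi_Q (repr a)^-1.

Let pi_mul x y : quotient_mul (\pi_Q x) (\pi_Q y) = \pi_Q (x * y).
Proof.
rewrite /quotient_mul; apply/esym/pi_eq.
set x' := repr (\pi_Q x); set y' := repr (\pi_Q y).
have -> : (x * y)^-1 * (x' * y') = (x^-1 * x') ^ y * (y^-1 * y').
  by rewrite invgM conjgE !mulgA mulgK.
by apply: subgroupM; [apply: subgroupJ|]; exact: pi_repr.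
Qed.

Let pi_inv x : quotient_inv (\pi_Q x) = \pi_Q x^-1.
Proof.
rewrite /quotient_inv; apply/pi_eq; set x' := repr (\pi_Q x).
have -> : x'^-1^-1 * x^-1 = (x^-1 * x') ^ x^-1.
  by rewrite conjgE !invgK !mulgA mulgV mul1g.
by apply: subgroupJ; exact: pi_repr.
Qed.

Let quotient_mulgA : associative quotient_mul.
Proof.
elim/quotW=> x; elim/quotW=> y; elim/quotW=> z.
by rewrite (pi_mul y z) (pi_mul x y) (pi_mul x) (pi_mul _ z) mulgA.
Qed.
Let quotient_mul1g : left_id quotient_one quotient_mul.
Proof. by elim/quotW=> x; rewrite pi_mul mul1g. Qed.
Let quotient_mulg1 : right_id quotient_one quotient_mul.
Proof. by elim/quotW=> x; rewrite pi_mul mulg1. Qed.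
Let quotient_mulVg : left_inverse quotient_one quotient_inv quotient_mul.
Proof. by elim/quotW=> x; rewrite pi_inv pi_mul mulVg. Qed.
Let quotient_mulgV : right_inverse quotient_one quotient_inv quotient_mul.
Proof. by elim/quotW=> x; rewrite pi_inv pi_mul mulgV. Qed.

HB.instance Definition _ := isGroup.Build Q quotient_mulgA
  quotient_mul1g quotient_mulg1 quotient_mulVg quotient_mulgV.

Let pi_open (U : set G) : open U -> open (\pi_Q @` U).
Proof.
move=> oU; rewrite /open/= /quotient_open.
rewrite (_ : _ @^-1` _ = \bigcup_(n in (N : set G)) ((fun x => x * n) @^-1` U)).
  apply: bigcup_open => n _; apply: open_comp oU => x _.
  apply: (@continuous_comp _ _ _ (fun x : G => (x, n))
    (fun x : G * G => x.1 * x.2)); last exact: mulg_continuous.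
  by apply: cvg_pair; [exact: cvg_id|exact: cvg_cst].
apply/seteqP; split=> [x [u Uu /esym/pi_eq Nxu]|x [n Nn Un]].
  by exists (x^-1 * u) => //=; rewrite mulKVg.
by exists (x * n) => //; apply/esym/pi_eq; rewrite mulKg.
Qed.

Let quotient_mulg_continuous : continuous (fun x : Q * Q => x.1 * x.2).
Proof.
move=> [a b] A; rewrite -[a]reprK -[b]reprK /=.
have -> : \pi_Q (repr a) * \pi_Q (repr b) = \pi_Q (repr a * repr b) by exact: pi_mul.
move=> /pi_continuous/(@mulg_continuous _ (_, _)) -[[U V] /= [+ +] UV].
rewrite {1}nbhsE => -[U' [oU' U'a] U'U].
rewrite {1}nbhsE => -[V' [oV' V'b] V'V].
exists (\pi_Q @` U', \pi_Q @` V').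
  by split; apply: open_nbhs_nbhs; split; (exact: pi_open || exact: imageP).
move=> [_ _] [/= [x U'x <-] [y V'y <-]] /=.
have -> : \pi_Q x * \pi_Q y = \pi_Q (x * y) by exact: pi_mul.
by apply: (UV (x, y)); split; [exact: U'U|exact: V'V].
Qed.

Let quotient_invg_continuous : continuous (fun x : Q => x^-1).
Proof.
apply/quotient_continuous.
rewrite (_ : _ \o _ = \pi_Q \o (fun x => x^-1)); last first.
  by apply/funext => x; exact: pi_inv.
by move=> x; apply: continuous_comp; [exact: invg_continuous|exact: pi_continuous].
Qed.

HB.instance Definition _ := Group_isTopologicalGroup.Build Q
  quotient_mulg_continuous quotient_invg_continuous.
End QuotientGroup.

Definition profinite (G : topGroupType) : Prop :=
  [/\ compact [set: G], hausdorff_space G & totally_disconnected [set: G]].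

Definition pro_p (p : nat) (G : topGroupType) : Prop :=
  profinite G /\
  forall N : normal_subgroup G, open (N : set G) ->
    exists k : nat, [set: topgroup_quotient N] #= `I_(p ^ k).

(* H^i(G, 'F_p) = Z^i / B^i for i = 1, 2, with continuous inhomogeneous cochains
   and trivial action. *)

Section Cohomology.
Local Open Scope ring_scope.
Variables (p : nat) (G : topGroupType).

Definition Cochain1 : set (G -> 'F_p) :=
  [set c | continuous (c : G -> discrete_topology 'F_p)].

Definition Cochain2 : set (G * G -> 'F_p) :=
  [set c | continuous (c : G * G -> discrete_topology 'F_p)].

Definition Z1 : set (G -> 'F_p) :=
  [set a | Cochain1 a /\ forall x y : G, a y - a (x * y)%g + a x = 0].

(* The action is trivial, so 0-cochains have zero coboundary. *)
Definition B1 : set (G -> 'F_p) := [set a | forall x, a x = 0].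

Definition Z2 : set (G * G -> 'F_p) :=
  [set f | Cochain2 f /\ forall x y z : G,
     f (y, z) - f ((x * y)%g, z) + f (x, (y * z)%g) - f (x, y) = 0].

Definition B2 : set (G * G -> 'F_p) :=
  [set f | exists2 c, Cochain1 c &
     forall x y : G, f (x, y) = c y - c (x * y)%g + c x].

Definition cup (a b : G -> 'F_p) : G * G -> 'F_p := fun x => a x.1 * b x.2.

End Cohomology.

(* For subspaces B <= Z of T -> 'F_p, the quotient Z / B has dimension d: it has
   a basis consisting of the classes of d elements of Z. *)
Definition quotient_dim (p : nat) (T : Type) (Z B : set (T -> 'F_p)) (d : nat)
    : Prop :=
  exists2 e : 'I_d -> T -> 'F_p, (forall i, Z (e i)) &
    forall z, Z z -> exists! c : {ffun 'I_d -> 'F_p},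
      B (fun t => z t - \sum_i c i * e i t)%R.

Definition dimH1 (p : nat) (G : topGroupType) : nat -> Prop :=
  quotient_dim (@Z1 p G) (@B1 p G).

Definition dimH2 (p : nat) (G : topGroupType) : nat -> Prop :=
  quotient_dim (@Z2 p G) (@B2 p G).

Definition cup_nondegenerate (p : nat) (G : topGroupType) : Prop :=
  (forall a : G -> 'F_p, Z1 a -> (forall b, Z1 b -> B2 (cup a b)) -> B1 a) /\
  (forall b : G -> 'F_p, Z1 b -> (forall a, Z1 a -> B2 (cup a b)) -> B1 b).

Definition demushkin (p : nat) (G : topGroupType) : Prop :=
  [/\ pro_p p G, exists d, dimH1 p G d, dimH2 p G 1 & cup_nondegenerate p G].

(* [G, G] is understood topologically: the closed subgroup generated by the
   commutators. *)
Section ClosedCommutator.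
Variable G : topGroupType.

Definition closed_commutator_set : set G :=
  [set x | forall H : subgroup G, closed (H : set G) ->
     (forall y z : G, (H : set G) [~ y, z]) -> (H : set G) x].

Let closed_commutator1 : closed_commutator_set 1.
Proof. by move=> H _ _; exact: subgroup1. Qed.
Let closed_commutatorM x y : closed_commutator_set x ->
  closed_commutator_set y -> closed_commutator_set (x * y).
Proof.
by move=> Cx Cy H cH HC; apply: subgroupM; [exact: Cx|exact: Cy].
Qed.
Let closed_commutatorV x : closed_commutator_set x ->
  closed_commutator_set x^-1.
Proof. by move=> Cx H cH HC; apply: subgroupV; exact: Cx. Qed.

Definition closed_commutator_sub : subgroup G :=
  Subgroup closed_commutator1 closed_commutatorM closed_commutatorV.

Let closed_commutatorJ (x y : G) :
  subgroup_set closed_commutator_sub x ->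
  subgroup_set closed_commutator_sub (x ^ y).
Proof.
move=> Cx H cH HC; rewrite (_ : x ^ y = x * [~ x, y]).
  by apply: subgroupM; [exact: Cx|exact: HC].
by rewrite commgEl mulKVg.
Qed.

Definition closed_commutator : normal_subgroup G :=
  NormalSubgroup closed_commutatorJ.

End ClosedCommutator.

(* The p-adic integers as the inverse limit of the Z / p ^ n.+1. This is the
   additive group of Z_p in multiplicative notation: the group law of 'Z_m in
   group_scope is addition. *)
Section PadicIntegers.
Variable p : nat.

Definition padic_factor (n : nat) : topGroupType :=
  discrete_topology 'Z_(p ^ n.+1).

Local Notation F := (topgroup_prod padic_factor).


Definition padic_compatible : set F :=
  [set x | forall n : nat, 
    ((x n.+1 : 'Z_(p ^ n.+2)) = (x n : 'Z_(p ^ n.+1)) %[mod p ^ n.+1])%N].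

Let compatible_mod (n a b : nat) :
  (a = b %[mod p ^ n.+1] ->
   a %% (Zp_trunc (p ^ n.+2)).+2 = b %% (Zp_trunc (p ^ n.+1)).+2
     %[mod p ^ n.+1])%N.
Proof.
have [p1|p1] := ltnP 1 p.
  rewrite !Zp_cast ?(ltn_exp2l 0)// modn_mod modn_dvdm//.
  by rewrite dvdn_exp2l.
case: (p) p1 => [|[|//]] _; first by rewrite !exp0n// !modn0 => ->.
by rewrite !exp1n !modn1.
Qed.

Let padic1 : padic_compatible (1 : F).
Proof. by move=> n. Qed.

Let padicM (x y : F) : padic_compatible x -> padic_compatible y ->
  padic_compatible (x * y).
Proof.
move=> cx cy n; apply: compatible_mod.
by rewrite -modnDm cx cy modnDm.
Qed.

Let padicV (x : F) : padic_compatible x -> padic_compatible x^-1.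
Proof.
move=> cx n; apply: compatible_mod; move: (cx n).
case: (x n.+1) (x n) => [a a_lt] [b b_lt] /= ab.
have [p1|p1] := ltnP 1 p; last first.
  case: (p) p1 a_lt b_lt ab => [|[|//]] _; last by rewrite !exp1n !modn1.
  by rewrite !exp0n// !modn0 => _ _ ->.
move: a_lt b_lt; rewrite !Zp_cast ?(ltn_exp2l 0)// => a_lt b_lt.
apply/eqP; rewrite -(eqn_modDr a) subnK 1?ltnW// -modnDmr ab modnDmr.
rewrite subnK 1?ltnW// modnn; apply/eqP/eqP.
by rewrite -/(dvdn _ _) dvdn_exp2l.
Qed.

Definition padic_subgroup : subgroup F := Subgroup padic1 padicM padicV.

Definition padic_int : Type := subgroup_type padic_subgroup.
HB.instance Definition _ := TopologicalGroup.on padic_int.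

Let padic_mulgC (x y : padic_int) : x * y = y * x.
Proof.
apply: val_inj; rewrite !valM; apply: functional_extensionality_dep => n.
exact: (@Zp_mulgC _ (val x n) (val y n)).
Qed.

Definition padic_multiple_set (q : nat) : set padic_int :=
  range (fun x : padic_int => x ^+ q).

Let padic_multiple1 q : padic_multiple_set q 1.
Proof. by exists 1 => //; rewrite expg1n. Qed.
Let padic_multipleM q x y : padic_multiple_set q x ->
  padic_multiple_set q y -> padic_multiple_set q (x * y).
Proof.
move=> [a _ <-] [b _ <-]; exists (a * b) => //.
by rewrite expgMn//; exact: padic_mulgC.
Qed.
Let padic_multipleV q x : padic_multiple_set q x -> padic_multiple_set q x^-1.
Proof. by move=> [a _ <-]; exists a^-1 => //; rewrite expVgn. Qed.

Definition padic_multiple_sub (q : nat) : subgroup padic_int :=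
  Subgroup (@padic_multiple1 q) (@padic_multipleM q) (@padic_multipleV q).

Let padic_multipleJ q (x y : padic_int) :
  subgroup_set (padic_multiple_sub q) x ->
  subgroup_set (padic_multiple_sub q) (x ^ y).
Proof. by rewrite conjgE padic_mulgC mulgK. Qed.

Definition padic_multiple (q : nat) : normal_subgroup padic_int :=
  NormalSubgroup (@padic_multipleJ q).

End PadicIntegers.

(* q = 0 is the convention p^oo = 0. *)
Definition is_q_invariant (p : nat) (G : topGroupType) (d q : nat) : Prop :=
  (q = 0%N \/ exists k : nat, q = (p ^ k)%N) /\
  topgroup_iso (topgroup_quotient (closed_commutator G))
    (topgroup_prod (fun _ : 'I_d.-1 => padic_int p : topGroupType)
     * topgroup_quotient (padic_multiple p q))%type.

Section Unitriangular.
Variables (n p : nat).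

Definition unitriangular : {set {'GL_n(p)}} :=
  [set g : {'GL_n(p)} | [forall i : 'I_n.-1.+1, forall j : 'I_n.-1.+1,
     (j <= i)%N ==> (GLval g i j == (i == j)%:R%R)]].

Lemma unitriangularP (g : {'GL_n(p)}) :
  reflect (forall i j : 'I_n.-1.+1, (j <= i)%N -> GLval g i j = (i == j)%:R%R)
          (g \in unitriangular).
Proof.
rewrite inE; apply: (iffP forallP) => [h i j ji|h i].
  by have /forallP/(_ j)/implyP/(_ ji)/eqP := h i.
by apply/forallP => j; apply/implyP => ji; apply/eqP; exact: h.
Qed.

Lemma unitriangular_group_set : group_set unitriangular.
Proof.
apply/group_setP; split=> [|g h].
  by apply/unitriangularP => i j _; rewrite GL_1E mxE.
move=> /unitriangularP Ug /unitriangularP Uh; apply/unitriangularP => i j ji.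
rewrite GL_MxE mxE (bigD1 i)//= Ug// eqxx mul1r Uh// big1 ?addr0// => k ki.
have [ik|ik] := leqP i k; last by rewrite Ug 1?ltnW// eq_sym (negPf ki) mul0r.
have jk : (j < k)%N.
  by apply: leq_ltn_trans ji _; rewrite ltn_neqAle ik andbT eq_sym.
by rewrite [X in (_ * X)%R]Uh 1?ltnW// -val_eqE gtn_eqF ?mulr0.
Qed.

Canonical unitriangular_group : {group {'GL_n(p)}} :=
  Group unitriangular_group_set.
End Unitriangular.

Definition Epi (G : topGroupType) (gT : finGroupType) (H : {group gT}) :
    set (G -> gT) :=
  [set f | [/\ {morph f : x y / x * y},
               continuous (f : G -> discrete_topology gT)
             & range f = [set` H]]].

Arguments Epi G {gT} H.

(* Main.v *)
(* A continuous homomorphism to U_4(F_p) is given by its entries: three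
   homomorphisms a, b, c on the superdiagonal, cochains x and y whose
   coboundaries are -(a u b) and -(b u c), and a corner z whose coboundary is
   minus the Massey cocycle a u y + x u c.  It is onto iff a, b, c are linearly
   independent.  So a, b, c must be independent with a u b = b u c = 0 in
   H^2 = F_p.  Then x and y range over torsors under H^1; replacing y by y + v
   changes the class of the Massey cocycle by a u v, which is a nonzero linear
   function of v by non-degeneracy, so p^(2d-1) pairs (x, y) have a corner, and
   z again ranges over a torsor: every triple contributes p^(3d-1) epimorphisms.
   The number of triples depends on whether the cup product is alternating.  It
   is for p odd; for p = 2 the square a u a vanishes iff a lifts to Z/4, and all
   a do iff q <> 2. *)

Require Import Defs.
From HB Require Import structures.
From mathcomp Require Import all_boot all_order all_algebra all_fingroup.
From mathcomp Require Import finmap all_classical topology.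
From mathcomp Require Import zify.
From Stdlib Require Import Ring.

Set Implicit Arguments.
Unset Strict Implicit.
Unset Printing Implicit Defensive.

Import GRing.Theory.

Local Open Scope ring_scope.

(** * Counting in finite sets and in finite vector spaces with a bilinear form *)

Lemma card_dep_pair (A B : finType) (P : pred A) (Q : A -> pred B) :
  #|[pred x : A * B | P x.1 && Q x.1 x.2]| = (\sum_(a | P a) #|Q a|)%N.
Proof.
rewrite -sum1_card -(pair_big_dep P Q (fun _ _ => 1%N)) /=.
by apply: eq_bigr => a _; rewrite sum1_card.
Qed.

(** Casting to a ring makes the difference exact, where subtraction of naturals would be
    truncated. *)
Lemma card_predD (R : pzRingType) (T : finType) (A B : pred T) :
  {subset B <= A} ->
  #|[pred x | A x && ~~ B x]|%:R = #|A|%:R - #|B|%:R :> R.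
Proof.
move=> sBA; have -> : #|B| = #|[predI A & B]|.
  apply: eq_card => x; rewrite !inE.
  by case: (boolP (x \in B)) => [/sBA->|]; rewrite ?andbF.
rewrite -(cardID B A) natrD addrAC subrr add0r; congr _%:R.
by apply: eq_card => x; rewrite !inE andbC.
Qed.

Section LinearCounting.
Variables (F : finFieldType) (d : nat).
Local Notation V := 'rV[F]_d.

Lemma card_rV : #|{: V}| = (#|F| ^ d)%N.
Proof. by rewrite card_mx mul1n. Qed.

(** Translation by a multiple of [w] carries the fiber over 0 onto any other fiber, so the [#|F|]
    fibers cut the space into equal parts. *)
Lemma card_linear_fiber (f : V -> F) (w : V) (t : F) :
  (forall k u v, f (k *: u + v) = k * f u + f v) -> f w != 0 -> (0 < d)%N ->
  #|[pred v | f v == t]| = (#|F| ^ (d - 1))%N.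
Proof.
move=> fL fw0 d0; pose fib t := #|[pred v | f v == t]|.
have fibE s : fib s = fib 0.
  pose w' := (s / f w) *: w.
  have shiftI : injective (fun v => w' + v) by exact: addrI.
  rewrite /fib -(fintype.card_image shiftI [pred v | f v == 0]).
  apply: eq_card => v.
  have fw' u : f (w' + u) = s + f u by rewrite fL divfK.
  apply/idP/fintype.imageP => [/eqP fv|[u /eqP fu ->]]; last first.
    by rewrite inE fw' fu addr0.
  exists (- w' + v); last by rewrite addNKr.
  by rewrite inE -(inj_eq (addrI s)) -fw' addNKr fv addr0 eqxx.
have F_gt0 : (0 < #|F|)%N by apply/card_gt0P; exists 0.
apply/eqP; rewrite -(eqn_pmul2r F_gt0) -expnSr subn1 prednK //.
rewrite -card_rV -[X in _ == X]sum1_card (partition_big f predT) //=.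
rewrite (eq_bigr (fun=> fib t)) => [|s _]; first by rewrite sum_nat_const mulnC.
by rewrite sum1_card -/(fib s) !fibE.
Qed.

Section Form.
Variables (B : V -> V -> F).
Hypotheses (Br : forall k u v v', B u (k *: v + v') = k * B u v + B u v').
Hypothesis (Bsym0 : forall u v, (B u v == 0) = (B v u == 0)).
Hypothesis (Bnd : forall u, u != 0 -> exists v, B u v != 0).
Hypothesis (d_gt0 : (0 < d)%N).

Local Notation q := (#|F|%:R : int).

Definition perp b := [pred v | B b v == 0].

Lemma perp_span b X : all (perp b) X -> {subset <<X>>%VS <= perp b}.
Proof.
move=> /allP pX v; pose f := B b.
have fL : linear_for *%R f by move=> k u u'; exact: Br.
pose fl : {linear V -> F^o} :=
  HB.pack f (GRing.isLinear.Build F V F^o *%R f fL).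
have kE u : (u \in lker (linfun fl)) = (u \in perp b).
  by rewrite memv_ker lfunE.
have sX : (<<X>> <= lker (linfun fl))%VS.
  by apply/span_subvP => u /pX; rewrite kE.
by move=> /(subvP sX); rewrite kE.
Qed.

Lemma card_perp b : b != 0 -> #|perp b| = (#|F| ^ (d - 1))%N.
Proof.
by case/Bnd => w Bw; apply: (card_linear_fiber (w := w)) => // k u v; exact: Br.
Qed.

Lemma card_span_free (X : seq V) : free X ->
  #|[pred v | v \in <<X>>%VS]| = (#|F| ^ size X)%N.
Proof.
move=> fX; pose comb (k : {ffun 'I_(size X) -> F}) := \sum_i k i *: X`_i.
have combI : injective comb.
  move=> k k' E; apply/ffunP => i.
  rewrite -(coord_sum_free k i (X := in_tuple X)) //.
  rewrite -[X in _ = X](coord_sum_free _ i (X := in_tuple X)) //.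
  by congr coord.
rewrite -[in RHS](card_ord (size X)) -card_ffun -(fintype.card_image combI).
apply: eq_card => v; apply/idP/fintype.imageP => [vX|[k _ ->]].
  exists [ffun i => coord (in_tuple X) i v] => //.
  rewrite {1}(coord_span (X := in_tuple X) vX).
  by apply: eq_bigr => i _; rewrite ffunE.
by apply: rpred_sum => i _; apply/rpredZ/memv_span/mem_nth.
Qed.

Lemma card_perp_nspan b (X : seq V) : b != 0 -> free X -> all (perp b) X ->
  #|[pred v | (v \in perp b) && (v \notin <<X>>%VS)]|%:R
    = q ^+ (d - 1) - q ^+ size X.
Proof.
move=> b0 fX pX; rewrite (card_predD _ (B := fun v => v \in <<X>>%VS)).
  by rewrite card_perp // -!natrX; congr (_ - _%:R); exact: card_span_free.
exact: perp_span.
Qed.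

(** [x] is the pair [(a, c)] of outer vectors around the middle vector [b]; with [c] listed first,
    [free_cons] peels off [c] and then [a]. *)
Definition triples (b : V) : nat :=
  #|[pred x : V * V | [&& free [:: x.2; x.1; b], B b x.1 == 0 & B b x.2 == 0]]|.

Lemma free_rot3 (a b c : V) : free [:: c; a; b] = free [:: b; c; a].
Proof.
by apply: perm_free; rewrite -[X in perm_eq X _]/(rot 1 [:: b; c; a]) perm_rot.
Qed.

Lemma triples0 : triples 0 = 0%N.
Proof. by apply: eq_card0 => x; rewrite !inE free_rot3 free_cons mem0v. Qed.

(** Here [b] lies in [perp b]: choose [a] in [perp b] off the line of [b], then [c] in [perp b] off
    the plane of [a] and [b]. *)
Lemma triples_isotropic b : b != 0 -> B b b = 0 ->
  (triples b)%:R = (q ^+ (d - 1) - q) * (q ^+ (d - 1) - q ^+ 2).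
Proof.
move=> b0 Bb0.
pose P : pred V := [pred a | (a \in perp b) && (a \notin <<[:: b]>>%VS)].
pose Q a : pred V := [pred c | (c \in perp b) && (c \notin <<[:: a; b]>>%VS)].
have -> : triples b = (\sum_(a | P a) #|Q a|)%N.
  rewrite -card_dep_pair; apply: eq_card => x.
  rewrite !inE /P /Q /= !inE 2!free_cons seq1_free b0 andbT.
  by do !case: (_ \in _); do !case: (_ == _).
rewrite natr_sum (eq_bigr (fun=> q ^+ (d - 1) - q ^+ 2)).
  rewrite sumr_const -[LHS]mulr_natl; congr (_ * _).
  rewrite -[in RHS](expr1 q) -(@card_perp_nspan b [:: b]) ?seq1_free //=.
  by rewrite andbT Bb0 eqxx.
move=> a /andP[pa na]; apply: (@card_perp_nspan b [:: a; b]) => //.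
  by rewrite free_cons seq1_free na b0.
by rewrite inE in pa; rewrite /= pa Bb0 eqxx.
Qed.

(** Now [b] lies outside [perp b], hence outside the span of any [a] and [c] in [perp b]. It remains
    to choose [a] nonzero and [c] off the line of [a]. *)
Lemma triples_anisotropic b : B b b != 0 ->
  (triples b)%:R = (q ^+ (d - 1) - 1) * (q ^+ (d - 1) - q).
Proof.
move=> Bb0; have b0 : b != 0.
  apply: contraNneq Bb0 => ->.
  by have := Br (-1) 0 0 0; rewrite scaler0 addr0 mulN1r addNr => ->.
pose P : pred V := [pred a | (a \in perp b) && (a \notin <<[::]>>%VS)].
pose Q a : pred V := [pred c | (c \in perp b) && (c \notin <<[:: a]>>%VS)].
have -> : triples b = (\sum_(a | P a) #|Q a|)%N.
  rewrite -card_dep_pair; apply: eq_card => x.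
  rewrite !inE /P /Q /= !inE free_rot3 !free_cons nil_free andbT.
  case pa: (B b x.1 == 0); last by rewrite !andbF.
  case pc: (B b x.2 == 0); last by rewrite !andbF.
  have -> : b \notin <<[:: x.2; x.1]>>%VS.
    by apply: contra Bb0 => /(perp_span _); apply; rewrite /= pa pc.
  by rewrite /= andbT andbC.
rewrite natr_sum (eq_bigr (fun=> q ^+ (d - 1) - q)).
  rewrite sumr_const -[LHS]mulr_natl; congr (_ * _).
  by rewrite (@card_perp_nspan b [::]) ?nil_free.
move=> a /andP[pa na]; apply: (@card_perp_nspan b [:: a]) => //.
  by rewrite !free_cons nil_free na.
by rewrite inE in pa; rewrite /= pa.
Qed.

(** [x] is [(b, (a, c))]: the middle vector comes first because the count is fibered over it. *)
Definition massey_triples :=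
  #|[pred x : V * (V * V) | [&& free [:: x.2.2; x.2.1; x.1],
       B x.2.1 x.1 == 0 & B x.1 x.2.2 == 0]]|.

Lemma massey_triplesE : massey_triples = (\sum_b triples b)%N.
Proof.
rewrite -(card_dep_pair predT (fun b => [pred x : V * V |
  [&& free [:: x.2; x.1; b], B b x.1 == 0 & B b x.2 == 0]])).
by apply: eq_card => x; rewrite !inE /= Bsym0.
Qed.

Lemma massey_triples_alternating : (forall v, B v v = 0) ->
  massey_triples%:R
    = (q ^+ d - 1) * (q ^+ (d - 1) - q) * (q ^+ (d - 1) - q ^+ 2).
Proof.
move=> B0; rewrite massey_triplesE (bigD1 0) //= triples0 add0n natr_sum.
rewrite (eq_bigr (fun=> (q ^+ (d - 1) - q) * (q ^+ (d - 1) - q ^+ 2))).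
  rewrite sumr_const -[LHS]mulr_natl mulrA; congr (_ * _ * _).
  rewrite (card_predD _ (A := predT) (B := pred1 0)) //.
  by rewrite card1 cardT -cardE card_rV natrX.
by move=> b b0; exact: triples_isotropic.
Qed.

(** The two hypotheses make the diagonal of [B] a nonzero linear form, so the isotropic vectors form
    a hyperplane. The summands count the triples with [b] isotropic and with [b] anisotropic. *)
Lemma massey_triples_nonalternating (w : V) :
  (forall k u v, B (k *: u + v) (k *: u + v) = k * B u u + B v v) ->
  B w w != 0 ->
  massey_triples%:R
    = (q ^+ (d - 1) - 1) * (q ^+ (d - 1) - q) * (q ^+ (d - 1) - q ^+ 2)
      + (q ^+ d - q ^+ (d - 1)) * ((q ^+ (d - 1) - 1) * (q ^+ (d - 1) - q)).
Proof.
move=> BL Bw; rewrite massey_triplesE natr_sum (bigID (fun b => B b b == 0)) /=.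
have B00 : B 0 0 = 0.
  by have := Br (-1) 0 0 0; rewrite scaler0 addr0 mulN1r addNr => ->.
have cZ : #|[pred b | B b b == 0]| = (#|F| ^ (d - 1))%N.
  exact: (card_linear_fiber (w := w)).
congr (_ + _).
  rewrite (bigD1 0) ?B00 //= triples0 add0r.
  rewrite (eq_bigr (fun=> (q ^+ (d - 1) - q) * (q ^+ (d - 1) - q ^+ 2))).
    rewrite sumr_const -[LHS]mulr_natl mulrA; congr (_ * _ * _).
    rewrite (card_predD _ (A := [pred b | B b b == 0]) (B := pred1 0)).
      by rewrite cZ card1 natrX.
    by move=> b /eqP ->; rewrite inE B00.
  by move=> b /andP[/eqP Bb b0]; exact: triples_isotropic.
rewrite (eq_bigr (fun=> (q ^+ (d - 1) - 1) * (q ^+ (d - 1) - q))).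
  rewrite sumr_const -[LHS]mulr_natl; congr (_ * _).
  rewrite (card_predD _ (A := predT) (B := [pred b | B b b == 0])) //.
  by rewrite cZ cardT -cardE card_rV !natrX.
by move=> b; exact: triples_anisotropic.
Qed.

End Form.
End LinearCounting.

(** * Ring normalization in F_p *)

Section FpRing.
Variable p : nat.
Local Notation F := 'F_p.

Definition Fp_zero : F := 0.
Definition Fp_one : F := 1.
Definition Fp_add (x y : F) : F := x + y.
Definition Fp_mul (x y : F) : F := x * y.
Definition Fp_opp (x : F) : F := - x.
Definition Fp_sub (x y : F) : F := x - y.

Lemma Fp_ring_theory :
  ring_theory Fp_zero Fp_one Fp_add Fp_mul Fp_sub Fp_opp eq.
Proof.
split=> //; [exact: add0r | exact: addrC | exact: addrA | exact: mul1r
  | exact: mulrC | exact: mulrA | exact: mulrDl | exact: subrr].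
Qed.
End FpRing.

(* The reifier of [ring] compares the ring operations syntactically, so every
   operation is first rewritten to one fixed constant, whatever canonical
   instance it carries. *)
Ltac Fp_ring_tac p := repeat (match goal with
  | |- context [@Algebra.add ?M ?x ?y] =>
      change (@Algebra.add M x y) with (@Fp_add p x y)
  | |- context [@Algebra.opp ?M ?x] =>
      change (@Algebra.opp M x) with (@Fp_opp p x)
  | |- context [@GRing.mul ?M ?x ?y] =>
      change (@GRing.mul M x y) with (@Fp_mul p x y)
  | |- context [@Algebra.zero ?M] => change (@Algebra.zero M) with (Fp_zero p)
  | |- context [@GRing.one ?M] => change (@GRing.one M) with (Fp_one p)
  end);
  match goal with |- @eq _ ?l ?r => change (@eq 'F_p l r) end; ring.

(** * Coordinates on the unitriangular group *)

Section U4.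
Variable p : nat.
Local Notation F := 'F_p.
Add Ring Fp_ring : (Fp_ring_theory p).
Local Ltac Fp_ring := Fp_ring_tac p.

Definition ut4_mx (a b c x y z : F) : 'M[F]_4 :=
  \matrix_(i, j) nth 0 (nth [::]
    [:: [:: 1; a; x; z];
        [:: 0; 1; b; y];
        [:: 0; 0; 1; c];
        [:: 0; 0; 0; 1]] i) j.

Lemma ut4_mxM a b c x y z a' b' c' x' y' z' :
  ut4_mx a b c x y z *m ut4_mx a' b' c' x' y' z' =
  ut4_mx (a + a') (b + b') (c + c') (x + x' + a * b') (y + y' + b * c')
    (z + z' + a * y' + x * c').
Proof.
apply/matrixP => i j; rewrite mxE !big_ord_recl big_ord0 !mxE /=.
by case: i => [[|[|[|[|//]]]] ?]; case: j => [[|[|[|[|//]]]] ?] /=; Fp_ring.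
Qed.

Lemma ut4_mx1 : ut4_mx 0 0 0 0 0 0 = 1%:M.
Proof.
apply/matrixP => i j; rewrite !mxE -val_eqE /=.
by case: i => [[|[|[|[|//]]]] ?]; case: j => [[|[|[|[|//]]]] ?].
Qed.

Lemma ut4_mx_unit a b c x y z : ut4_mx a b c x y z \is a GRing.unit.
Proof.
(* The second factor solves the product formula for the identity, from the superdiagonal up to the
   corner. *)
have /mulmx1_unit[] // : ut4_mx a b c x y z *m
  ut4_mx (- a) (- b) (- c) (- x + a * b) (- y + b * c)
    (- z + a * y - a * b * c + x * c) = 1%:M.
by rewrite ut4_mxM -ut4_mx1; congr ut4_mx; Fp_ring.
Qed.

Definition ut4 a b c x y z : {'GL_4(p)} :=
  FinRing.unit _ (ut4_mx_unit a b c x y z).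

Lemma ut4M a b c x y z a' b' c' x' y' z' :
  (ut4 a b c x y z * ut4 a' b' c' x' y' z')%g =
  ut4 (a + a') (b + b') (c + c') (x + x' + a * b') (y + y' + b * c')
    (z + z' + a * y' + x * c').
Proof. by apply: val_inj; exact: ut4_mxM. Qed.

Lemma ut4_1 : ut4 0 0 0 0 0 0 = 1%g.
Proof. by apply: val_inj; exact: ut4_mx1. Qed.

Lemma ut4V a b c x y z :
  (ut4 a b c x y z)^-1%g = ut4 (- a) (- b) (- c) (- x + a * b) (- y + b * c)
    (- z + a * y - a * b * c + x * c).
Proof.
apply/eqP; rewrite eq_invg_mul ut4M -ut4_1; apply/eqP.
by congr ut4; Fp_ring.
Qed.

Lemma ut4_unitriangular a b c x y z :
  ut4 a b c x y z \in unitriangular_group 4 p.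
Proof.
apply/unitriangularP => i j; rewrite mxE -val_eqE.
by case: i => [[|[|[|[|//]]]] ?]; case: j => [[|[|[|[|//]]]] ?].
Qed.

Lemma unitriangular_ut4 (g : {'GL_4(p)}) : g \in unitriangular_group 4 p ->
  let e i j := GLval g (inord i) (inord j) in
  g = ut4 (e 0 1) (e 1 2) (e 2 3) (e 0 2) (e 1 3) (e 0 3).
Proof.
move=> /unitriangularP Ug e; apply: val_inj; apply/matrixP => i j.
have -> : val g i j = e i j by rewrite /e !inord_val.
have e0 (i' j' : nat) : (i' < 4)%N -> (j' <= i')%N -> e i' j' = (i' == j')%:R.
  move=> i4 ji; have j4 := leq_ltn_trans ji i4.
  by rewrite /e Ug ?inordK // -(inj_eq val_inj) /= !inordK.
rewrite mxE.
by case: i => [[|[|[|[|//]]]] ?]; case: j => [[|[|[|[|//]]]] ?]; rewrite //= e0.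
Qed.

Lemma ut4_inj a b c x y z a' b' c' x' y' z' :
  ut4 a b c x y z = ut4 a' b' c' x' y' z' ->
  a = a' /\ b = b' /\ c = c' /\ x = x' /\ y = y' /\ z = z'.
Proof.
move=> /(congr1 GLval)/matrixP E.
do !split; [move: (E (inord 0) (inord 1)) | move: (E (inord 1) (inord 2))
  | move: (E (inord 2) (inord 3)) | move: (E (inord 0) (inord 2))
  | move: (E (inord 1) (inord 3)) | move: (E (inord 0) (inord 3))];
  by rewrite !mxE !inordK.
Qed.

(* Commutators of elements with prescribed superdiagonals fill the other
   entries. *)
Lemma ut4_generation (P : {'GL_4(p)} -> Prop) :
  (forall g h, P g -> P h -> P (g * h)%g) -> (forall g, P g -> P g^-1%g) ->
  (forall a b c, exists x y z, P (ut4 a b c x y z)) ->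
  forall g, g \in unitriangular_group 4 p -> P g.
Proof.
move=> PM PV Pabc g /unitriangular_ut4/=.
move: (GLval g _ _) (GLval g _ _) (GLval g _ _) (GLval g _ _) (GLval g _ _)
  (GLval g _ _) => z y x c b a ->.
(* This is the commutator of [u] and [v]. In the next two steps the unknown upper entries of the
   chosen elements affect only its corner. *)
have PR u v : P u -> P v -> P (u * v * (v * u)^-1)%g.
  by move=> Pu Pv; exact: PM (PM _ _ Pu Pv) (PV _ (PM _ _ Pv Pu)).
have P13 t : exists z', P (ut4 0 0 0 t 0 z').
  have [x1 [y1 [z1 P1]]] := Pabc t 0 0; have [x2 [y2 [z2 P2]]] := Pabc 0 1 0.
  have := PR _ _ P1 P2; rewrite !(ut4M, ut4V) => PP; eexists.
  by move: PP; congr P; congr ut4; Fp_ring.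
have P24 t : exists z', P (ut4 0 0 0 0 t z').
  have [x1 [y1 [z1 P1]]] := Pabc 0 1 0; have [x2 [y2 [z2 P2]]] := Pabc 0 0 t.
  have := PR _ _ P1 P2; rewrite !(ut4M, ut4V) => PP; eexists.
  by move: PP; congr P; congr ut4; Fp_ring.
(* A commutator of positions (1, 2) and (2, 4) has corner exactly [t], whatever the unknown entries
   are. *)
have P14 t : P (ut4 0 0 0 0 0 t).
  have [x1 [y1 [z1 P1]]] := Pabc t 0 0; have [z2 P2] := P24 1.
  have := PR _ _ P1 P2; rewrite !(ut4M, ut4V).
  by congr P; congr ut4; Fp_ring.
have [x1 [y1 [z1 P1]]] := Pabc a b c.
have [z2 P2] := P13 (x - x1); have [z3 P3] := P24 (y - y1).
(* The last factor corrects the corner; [(x - x1) * c] is what multiplying the (1, 3) entry by the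
   superdiagonal entry [c] adds there. *)
have := PM _ _ (PM _ _ (PM _ _ P2 P3) P1)
  (P14 (z - z1 - z2 - z3 - (x - x1) * c)).
by rewrite !ut4M; congr P; congr ut4; Fp_ring.
Qed.
End U4.

(** * Continuous cochains, cup products and coboundaries *)

Local Open Scope classical_set_scope.

Lemma continuous_discreteP (T : topologicalType) (X : choiceType) (f : T -> X) :
  continuous (f : T -> discrete_topology X)
    <-> forall x, nbhs x [set y | f y = f x].
Proof.
split=> [cf x|cf x].
  exact: (cf x _ (discrete_set1 (f x : discrete_topology X))).
by apply/discrete_cvg; exact: cf.
Qed.

Section Cochains.
Variables (p : nat) (G : topGroupType).
Local Notation F := 'F_p.
Add Ring Fp_ring : (Fp_ring_theory p).
Local Ltac Fp_ring := Fp_ring_tac p.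
Implicit Types (a b c : G -> F) (f g : G * G -> F).

Lemma Cochain1P a : Cochain1 a <-> forall x, nbhs x [set y | a y = a x].
Proof. exact: continuous_discreteP. Qed.

Lemma Cochain2P f : Cochain2 f <-> forall x, nbhs x [set y | f y = f x].
Proof. exact: continuous_discreteP. Qed.

Lemma Cochain1_map2 (op : F -> F -> F) a b :
  Cochain1 a -> Cochain1 b -> Cochain1 (fun x => op (a x) (b x)).
Proof.
move=> /Cochain1P ca /Cochain1P cb; apply/Cochain1P => x.
by apply: filterS (filterI (ca x) (cb x)) => y [/= -> ->].
Qed.

Lemma Cochain2_map2 (op : F -> F -> F) f g :
  Cochain2 f -> Cochain2 g -> Cochain2 (fun x => op (f x) (g x)).
Proof.
move=> /Cochain2P ca /Cochain2P cb; apply/Cochain2P => x.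
by apply: filterS (filterI (ca x) (cb x)) => y [/= -> ->].
Qed.

Arguments Cochain1_map2 op {a b}.
Arguments Cochain2_map2 op {f g}.

Lemma Cochain2_comp (h : G * G -> G) a :
  continuous h -> Cochain1 a -> Cochain2 (a \o h).
Proof.
by move=> ch /Cochain1P ca; apply/Cochain2P => x; exact: ch x _ (ca _).
Qed.

Lemma Cochain2_fst a : Cochain1 a -> Cochain2 (fun x => a x.1).
Proof. by apply: Cochain2_comp => x; exact: cvg_fst. Qed.

Lemma Cochain2_snd a : Cochain1 a -> Cochain2 (fun x => a x.2).
Proof. by apply: Cochain2_comp => x; exact: cvg_snd. Qed.

Lemma Cochain2_mul a : Cochain1 a -> Cochain2 (fun x => a (x.1 * x.2)%g).
Proof. by apply: Cochain2_comp => x; exact: mulg_continuous. Qed.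

Lemma Cochain2_cup a b : Cochain1 a -> Cochain1 b -> Cochain2 (cup a b).
Proof.
move=> /Cochain2_fst ca /Cochain2_snd cb.
exact: (Cochain2_map2 (fun s t => s * t) ca cb).
Qed.

Lemma Z1P a : Z1 a <-> Cochain1 a /\ forall x y, a (x * y)%g = a x + a y.
Proof.
split=> -[ca aM]; split=> // x y; last by rewrite aM; Fp_ring.
transitivity (a x + a y - (a y - a (x * y)%g + a x)); first by Fp_ring.
by rewrite aM subr0.
Qed.

Lemma Z1_lin k a b : Z1 a -> Z1 b -> Z1 (fun x => k * a x + b x).
Proof.
move=> /Z1P[ca aM] /Z1P[cb bM]; apply/Z1P; split.
  exact: (Cochain1_map2 (fun s t => k * s + t) ca cb).
by move=> x y; rewrite aM bM; Fp_ring.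
Qed.

Lemma Z2_lin k f g : Z2 f -> Z2 g -> Z2 (fun x => k * f x + g x).
Proof.
move=> [cf fZ] [cg gZ]; split.
  exact: (Cochain2_map2 (fun s t => k * s + t) cf cg).
move=> x y z.
transitivity (k * (f (y, z) - f ((x * y)%g, z) + f (x, (y * z)%g) - f (x, y)) +
  (g (y, z) - g ((x * y)%g, z) + g (x, (y * z)%g) - g (x, y))).
  by Fp_ring.
by rewrite fZ gZ mulr0 addr0.
Qed.

Lemma B2_lin k f g : B2 f -> B2 g -> B2 (fun x => k * f x + g x).
Proof.
move=> [c cc fE] [c' cc' gE]; exists (fun x => k * c x + c' x).
  exact: (Cochain1_map2 (fun s t => k * s + t) cc cc').
by move=> x y; rewrite fE gE; Fp_ring.
Qed.

Lemma B2_Z2 f : B2 f -> Z2 f.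
Proof.
move=> [c cc fE]; split; last first.
  move=> x y z; have xyzE : (x * (y * z) = x * y * z)%g by exact: mulgA.
  by rewrite !fE xyzE; Fp_ring.
have -> : f = fun x => c x.2 - c (x.1 * x.2)%g + c x.1.
  by apply/funext => -[x y]; exact: fE.
exact: (Cochain2_map2 (fun s t => s + t) (Cochain2_map2 (fun s t => s - t)
  (Cochain2_snd cc) (Cochain2_mul cc)) (Cochain2_fst cc)).
Qed.

Lemma Z2_cup a b : Z1 a -> Z1 b -> Z2 (cup a b).
Proof.
move=> /Z1P[ca aM] /Z1P[cb bM]; split; first exact: Cochain2_cup.
by move=> x y z; rewrite /cup /= aM bM; Fp_ring.
Qed.

(* [s] and [t] form a defining system of the Massey product <a, b, c>. *)
Lemma Z2_massey a b c s t : Z1 a -> Z1 b -> Z1 c ->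
  Cochain1 s -> (forall x y, s (x * y)%g = s x + s y + a x * b y) ->
  Cochain1 t -> (forall x y, t (x * y)%g = t x + t y + b x * c y) ->
  Z2 (fun x => cup a t x + cup s c x).
Proof.
move=> /Z1P[ca aM] /Z1P[cb bM] /Z1P[cc cM] cs sM ct tM; split.
  exact: (Cochain2_map2 (fun s t => s + t) (Cochain2_cup ca ct)
    (Cochain2_cup cs cc)).
by move=> x y z; rewrite /cup /= aM cM sM tM; Fp_ring.
Qed.

(** Replacing [c] by [- c] turns a coboundary into a defect of additivity, the shape in which upper
    matrix entries multiply. *)
Lemma B2P f : B2 f <->
  exists2 c, Cochain1 c & forall x y, c (x * y)%g = c x + c y + f (x, y).
Proof.
split=> -[c cc fE]; exists (fun x => - c x);
  try exact: (Cochain1_map2 (fun s _ => - s) cc cc).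
  by move=> x y /=; rewrite fE; Fp_ring.
move=> x y /=; rewrite fE opprK [c x + c y]addrC -[c y + c x + _]addrA addKr.
by rewrite [c x + _]addrC addrK.
Qed.

(** The pointwise product of [a] and [b] is a primitive. *)
Lemma B2_cup_anticomm a b : Z1 a -> Z1 b -> B2 (fun x => cup a b x + cup b a x).
Proof.
move=> /Z1P[ca aM] /Z1P[cb bM]; apply/B2P; exists (fun x => a x * b x).
  exact: (Cochain1_map2 (fun s t => s * t) ca cb).
by move=> x y; rewrite /cup /= aM bM; Fp_ring.
Qed.

(** The cross terms of the square are [k] times [cup a b] plus [cup b a], a coboundary. Hence the
    classes with trivial cup square form a subspace. *)
Lemma B2_cup_self_lin k a b :
  Z1 a -> Z1 b -> B2 (cup a a) -> B2 (cup b b) ->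
  B2 (cup (fun x => k * a x + b x) (fun x => k * a x + b x)).
Proof.
move=> Za Zb Ba Bb.
have := B2_lin (k * k) Ba (B2_lin k (B2_cup_anticomm Za Zb) Bb).
congr B2; apply/funext => x; rewrite /cup !mulrDl !mulrDr !mulrA !addrA.
by rewrite [k * a x.1 * k]mulrAC [b x.1 * k]mulrC.
Qed.

(** As 2 is invertible, half the pointwise square of [a] is a primitive. *)
Lemma B2_cup_self_odd a : prime p -> p != 2%N -> Z1 a -> B2 (cup a a).
Proof.
move=> p_pr p2 /Z1P[ca aM].
have two_neq0 : 1 + 1 != 0 :> F.
  rewrite -[1 + 1]/(2%:R) -(dvdn_pcharf (pchar_Fp p_pr)) dvdn_prime2 //.
have [h hE] : exists h : F, h * (1 + 1) = 1 by exists (1 + 1)^-1; rewrite mulVf.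
apply/B2P; exists (fun x => h * (a x * a x)).
  exact: (Cochain1_map2 (fun s t => h * (s * t)) ca ca).
move=> x y; rewrite /cup /= aM -[a x * a y]mul1r -hE; Fp_ring.
Qed.

(** The rows of simultaneous values form a subspace, and a linear form vanishing on it would be a
    relation among the [f i]; so it is the whole space. *)
Lemma joint_surjective n (f : 'I_n -> G -> F) :
  (forall i x y, f i (x * y)%g = f i x + f i y) ->
  (forall k : 'I_n -> F, (forall x : G, \sum_i k i * f i x = 0) ->
    forall i, k i = 0) ->
  forall r : 'I_n -> F, exists x : G, forall i, f i x = r i.
Proof.
move=> fM f_free r.
have f1 i : f i 1%g = 0.
  by apply: (addrI (f i 1%g)); rewrite -fM mul1g addr0.
have fX i x m : f i (x ^+ m)%g = m%:R * f i x.
  elim: m => [|m IH]; first by rewrite expg0 f1 mul0r.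
  by rewrite expgS fM IH -natr1; Fp_ring.
pose row (g : G) := \row_i f i g.
pose S := [pred v : 'rV[F]_n | `[< exists g : G, v = row g >]].
pose M := \matrix_(i < #|S|) (enum_val i : 'rV[F]_n).
have SD u v : u \in S -> v \in S -> u + v \in S.
  move=> /asboolP[x ->] /asboolP[y ->]; apply/asboolP; exists (x * y)%g.
  by apply/rowP => i; rewrite !mxE fM.
(* Scalars of the prime field are natural multiples, realized by powers in [G]. *)
have SZ (k : F) u : u \in S -> k *: u \in S.
  move=> /asboolP[x ->]; apply/asboolP; exists (x ^+ k)%g.
  by apply/rowP => i; rewrite !mxE fX natr_Zp.
have S0 : 0 \in S.
  by apply/asboolP; exists 1%g; apply/rowP => i; rewrite !mxE f1.
(* Each column of the cokernel of [M] is a linear relation among the [f i]. *)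
have Mfull : row_full M.
  rewrite -cokermx_eq0; apply/eqP/matrixP => i j; rewrite [RHS]mxE.
  apply: (f_free (fun i => cokermx M i j)) => g {i}.
  have gS : row g \in S by apply/asboolP; exists g.
  have := congr1 (fun A : 'M_(_, _) => A (enum_rank_in gS (row g)) j)
    (mulmx_coker M).
  rewrite /= !mxE => E; rewrite -[RHS]E; apply: eq_bigr => i _.
  by rewrite [M _ i]mxE enum_rankK_in // [row g _ _]mxE mulrC.
have /submxP[D DE] := submx_full (\row_i r i) Mfull.
have : \row_i r i \in S.
  rewrite DE mulmx_sum_row; elim/big_ind: _ => // i _.
  by apply: SZ; rewrite rowK; exact: enum_valP.
move=> /asboolP[g /rowP gE]; exists g => i.
by have := gE i; rewrite !mxE.
Qed.

End Cochains.
Arguments Cochain1_map2 {p G} op {a b}.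

(** This passes from the cardinality of a classical set to a count in a finite type, through a
    parametrization injective on [D]. *)
Lemma card_image_finpred (T : finType) (U : choiceType) (f : T -> U)
    (D : pred T) (A : set U) :
  {in D &, injective f} -> A = f @` [set x | D x] ->
  finite_set A /\ #|` fset_set A| = #|D|.
Proof.
move=> fI ->; split; first exact/finite_image/finite_finset.
rewrite fset_set_image; last exact: finite_finset.
rewrite card_in_imfset /=; last first.
  move=> x y; rewrite !in_fset_set; [|exact: finite_finset..].
  by rewrite !inE; exact: fI.
rewrite cardE; apply/perm_size/uniq_perm;
  [exact: fset_uniq | exact: enum_uniq |].
move=> x; rewrite mem_enum in_fset_set; last exact: finite_finset.
by apply/idP/idP; rewrite in_setE.
Qed.

(** * Coordinates on H^2 and H^1 *)

Section Demushkin.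
Variables (p : nat) (G : topGroupType).
Local Notation F := 'F_p.
Add Ring Fp_ring : (Fp_ring_theory p).
Local Ltac Fp_ring := Fp_ring_tac p.

(** [h] is the coordinate of a class in the one-element basis of H^2; it turns questions about
    coboundaries into equations in F_p. *)
Lemma dimH2_functional : dimH2 p G 1 ->
  exists h : (G * G -> F) -> F,
    (forall f, Z2 f -> (h f = 0 <-> B2 f)) /\
    (forall k f g, Z2 f -> Z2 g ->
       h (fun x => k * f x + g x) = k * h f + h g).
Proof.
move=> [e Ze eP]; pose e0 := e ord0.
have ex f : exists t : F, Z2 f -> B2 (fun x => 1 * f x + (- t) * e0 x).
  (* Off the cocycles the value 0 is a placeholder. *)
  have [Zf|nZ] := pselect (Z2 f); last by exists 0.
  have [c [Bc _]] := eP f Zf; exists (c ord0) => _; move: Bc.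
  by congr B2; apply/funext => x; rewrite big_ord1 /e0; Fp_ring.
have uniq f s t : Z2 f -> B2 (fun x => 1 * f x + (- t) * e0 x) ->
    B2 (fun x => 1 * f x + (- s) * e0 x) -> s = t.
  move=> Zf Bt Bs; have [c [_ cU]] := eP f Zf.
  have E r : B2 (fun x => 1 * f x + (- r) * e0 x) -> c = [ffun=> r].
    move=> Br; apply: cU; move: Br; congr B2; apply/funext => x.
    by rewrite big_ord1 ffunE /e0; Fp_ring.
  by have := E t Bt; rewrite (E s Bs) => /ffunP/(_ ord0); rewrite !ffunE.
have [h hP] := choice ex; exists h; split=> [f Zf|k f g Zf Zg].
  have fE : f = fun x => 1 * f x + (- 0) * e0 x by apply/funext => x; Fp_ring.
  split=> [h0|Bf]; first by have := hP f Zf; rewrite h0 -fE.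
  by apply: (uniq f) => //; [rewrite -fE | exact: hP].
apply: (uniq (fun x => k * f x + g x)); first exact: Z2_lin.
  have := B2_lin k (hP f Zf) (hP g Zg); congr B2; apply/funext => x.
  by Fp_ring.
by apply: hP; exact: Z2_lin.
Qed.

(** Since [B1] contains only zero, H^1 is [Z1] itself, and the chosen basis identifies it with row
    vectors. *)
Lemma dimH1_coordinates d : dimH1 p G d ->
  exists ev : 'rV[F]_d -> G -> F,
    [/\ forall v, Z1 (ev v),
        forall k u v, ev (k *: u + v) = (fun x => k * ev u x + ev v x),
        forall a, Z1 a -> exists v, a = ev v
      & forall v, (forall x, ev v x = 0) -> v = 0].
Proof.
move=> [e Ze eP].
pose ev (v : 'rV[F]_d) x := \sum_i v ord0 i * e i x.
have evL k u v : ev (k *: u + v) = (fun x => k * ev u x + ev v x).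
  apply/funext => x; rewrite /ev mulr_sumr -big_split; apply: eq_bigr => i _ /=.
  by rewrite !mxE mulrDl mulrA.
have ev0 : ev 0 = fun=> 0.
  by apply/funext => x; apply: big1 => i _; rewrite mxE mul0r.
have Z10 : @Z1 p G (fun=> 0).
  apply/Z1P; split; last by move=> *; rewrite addr0.
  by apply/Cochain1P => x; exact: filterE.
exists ev; split=> //.
- move=> v; rewrite /ev; elim: (index_enum _) => [|i s Zs].
    by under eq_fun do rewrite big_nil.
  by under eq_fun do rewrite big_cons; exact: Z1_lin.
- move=> a /eP[c [Bc _]]; exists (\row_i c i); apply/funext => x.
  have := Bc x => /subr0_eq ->; apply: eq_bigr => i _; by rewrite mxE.
- move=> v v0; have [c [_ cU]] := eP _ Z10.
  have cE (w : 'rV[F]_d) : (forall x, ev w x = 0) -> c = [ffun i => w ord0 i].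
    move=> w0; apply: cU => x; rewrite sub0r -[RHS]oppr0 -[in RHS](w0 x).
    by congr (- _); apply: eq_bigr => i _; rewrite ffunE.
  have := cE v v0; rewrite (cE 0) => [/ffunP E|x]; last by rewrite ev0.
  by apply/rowP => i; have := E i; rewrite !ffunE.
Qed.
End Demushkin.

(** * Homomorphisms to U_4 through their matrix entries *)

Section Epi.
Variables (p : nat) (G : topGroupType).
Local Notation F := 'F_p.
Add Ring Fp_ring : (Fp_ring_theory p).
Local Ltac Fp_ring := Fp_ring_tac p.
Local Notation U := (unitriangular_group 4 p).

(* The entries of a continuous homomorphism to U_4: superdiagonal a, b, c, then
   x in position (1, 3), y in position (2, 4) and z in the corner. *)
Definition ut4_data (a b c x y z : G -> F) : Prop :=
  [/\ [/\ Z1 a, Z1 b & Z1 c], [/\ Cochain1 x, Cochain1 y & Cochain1 z],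
      forall g h, x (g * h)%g = x g + x h + a g * b h,
      forall g h, y (g * h)%g = y g + y h + b g * c h
    & forall g h, z (g * h)%g = z g + z h + (cup a y (g, h) + cup x c (g, h))].

Lemma Epi_ut4 (f : G -> {'GL_4(p)}) : Epi G U f ->
  exists a b c x y z,
    [/\ f = (fun g => ut4 (a g) (b g) (c g) (x g) (y g) (z g)),
        ut4_data a b c x y z
      & forall i j k, exists g, [/\ a g = i, b g = j & c g = k]].
Proof.
move=> [fM fcont frange]; pose e i j g := GLval (f g) (inord i) (inord j).
have fE g :
    f g = ut4 (e 0 1 g) (e 1 2 g) (e 2 3 g) (e 0 2 g) (e 1 3 g) (e 0 3 g).
  apply: unitriangular_ut4; have : range f (f g) by exists g.
  by rewrite frange.
have eC i j : Cochain1 (e i j).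
  apply/Cochain1P => x; move/continuous_discreteP: fcont => /(_ x).
  by apply: filterS => y; rewrite /e => /= ->.
have eqs g h := ut4_inj (etrans (esym (fE (g * h)%g)) (etrans (fM g h)
  (etrans (congr2 _ (fE g) (fE h)) (ut4M _ _ _ _ _ _ _ _ _ _ _ _)))).
exists (e 0 1), (e 1 2), (e 2 3), (e 0 2), (e 1 3), (e 0 3); split.
- exact/funext.
- split; [split; apply/Z1P; split=> // g h | by split | move=> g h..];
    have [E1 [E2 [E3 [E4 [E5 E6]]]]] := eqs g h;
    rewrite ?E1 ?E2 ?E3 ?E4 ?E5 ?E6 // /cup /=; Fp_ring.
- move=> i j k; have : [set` U] (ut4 i j k 0 0 0) by exact: ut4_unitriangular.
  rewrite -frange => -[g _]; rewrite fE => /ut4_inj[? [? [? _]]].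
  by exists g.
Qed.

(** By [ut4_generation], a subgroup that meets every superdiagonal is the whole group, so
    surjectivity need only be known for [a], [b], [c]. *)
Lemma ut4_Epi (a b c x y z : G -> F) : ut4_data a b c x y z ->
  (forall i j k, exists g, [/\ a g = i, b g = j & c g = k]) ->
  Epi G U (fun g => ut4 (a g) (b g) (c g) (x g) (y g) (z g)).
Proof.
move=> [[/Z1P[ca aM] /Z1P[cb bM] /Z1P[cc cM]] [cx cy cz] xM yM zM] surj.
set f := (fun g => _).
have fM : {morph f : g h / (g * h)%g}.
  move=> g h; rewrite /f aM bM cM xM yM zM ut4M /cup /=.
  by congr ut4; Fp_ring.
split=> //.
  apply/continuous_discreteP => g; rewrite /f.
  move: ca cb cc cx cy cz => /Cochain1P/(_ g) ca /Cochain1P/(_ g) cb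
    /Cochain1P/(_ g) cc /Cochain1P/(_ g) cx /Cochain1P/(_ g) cy
    /Cochain1P/(_ g) cz.
  apply: filterS (filterI (filterI (filterI ca cb) (filterI cc cx))
    (filterI cy cz)).
  by move=> h [[[/= -> ->] [/= -> ->]] [/= -> ->]].
have f1 : f 1%g = 1%g.
  by apply: (mulgI (f 1%g)); rewrite -fM !mulg1.
apply/seteqP; split=> [_ [g _ <-]|g Ug]; first exact: ut4_unitriangular.
apply: (@ut4_generation p (range f)) Ug
  => [_ _ [g1 _ <-] [g2 _ <-]|_ [g1 _ <-]|i j k].
- by exists (g1 * g2)%g.
- exists g1^-1%g => //; apply: (mulgI (f g1)); by rewrite -fM !mulgV.
- have [g1 [<- <- <-]] := surj i j k; exists (x g1), (y g1), (z g1).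
  by exists g1.
Qed.

End Epi.

(** * The cup form, and counting epimorphisms by defining systems *)

Section Count.
Variables (p : nat) (p_pr : prime p) (G : topGroupType) (d : nat).
Local Notation F := 'F_p.
Add Ring Fp_ring : (Fp_ring_theory p).
Local Ltac Fp_ring := Fp_ring_tac p.
Local Notation U := (unitriangular_group 4 p).
Local Notation V := 'rV[F]_d.

Variable h : (G * G -> F) -> F.
Hypothesis hP : forall f, Z2 f -> (h f = 0 <-> B2 f).
Hypothesis hL : forall k f g, Z2 f -> Z2 g ->
  h (fun x => k * f x + g x) = k * h f + h g.
Variable ev : V -> G -> F.
Hypothesis evZ : forall v, Z1 (ev v).
Hypothesis evL : forall k u v, ev (k *: u + v) = (fun x => k * ev u x + ev v x).
Hypothesis ev_surj : forall a, Z1 a -> exists v, a = ev v.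
Hypothesis ev_eq0 : forall v, (forall x, ev v x = 0) -> v = 0.

Definition cup_form (u v : V) : F := h (cup (ev u) (ev v)).

Lemma cup_form_linl k u u' v :
  cup_form (k *: u + u') v = k * cup_form u v + cup_form u' v.
Proof.
rewrite /cup_form -hL; try exact: Z2_cup.
by congr h; apply/funext => x; rewrite evL /cup; Fp_ring.
Qed.

Lemma cup_form_linr k u v v' :
  cup_form u (k *: v + v') = k * cup_form u v + cup_form u v'.
Proof.
rewrite /cup_form -hL; try exact: Z2_cup.
by congr h; apply/funext => x; rewrite evL /cup; Fp_ring.
Qed.

Lemma cup_form_anticomm u v : cup_form u v + cup_form v u = 0.
Proof.
rewrite -[cup_form u v]mul1r -hL; try exact: Z2_cup.
have /hP <- := B2_cup_anticomm (evZ u) (evZ v); last first.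
  exact/B2_Z2/B2_cup_anticomm.
by congr h; apply/funext => x; Fp_ring.
Qed.

Lemma cup_form_sym0 u v : (cup_form u v == 0) = (cup_form v u == 0).
Proof.
by apply/eqP/eqP => E; have := cup_form_anticomm u v; rewrite E ?add0r ?addr0.
Qed.

Lemma cup_form_nondegenerate : cup_nondegenerate p G ->
  forall u, u != 0 -> exists v, cup_form u v != 0.
Proof.
move=> [nd _] u; apply: contraPP => /forallNP uP.
suff -> : u = 0 by rewrite eqxx.
apply/ev_eq0/(nd (ev u)) => // _ /ev_surj[v ->].
apply/hP; first exact: Z2_cup.
by apply/eqP/negPn/negP/uP.
Qed.

Lemma ev0 x : ev 0 x = 0.
Proof. by have := evL (-1) 0 0; rewrite scaler0 addr0 => ->; Fp_ring. Qed.

Lemma ev_inj : injective ev.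
Proof.
move=> u v E; apply/subr0_eq/ev_eq0 => x.
by rewrite addrC -scaleN1r evL E; Fp_ring.
Qed.

Lemma ev_sum n (k : 'I_n -> F) (X : 'I_n -> V) x :
  ev (\sum_i k i *: X i) x = \sum_i k i * ev (X i) x.
Proof.
elim: (index_enum _) => [|i s IH]; first by rewrite !big_nil ev0.
by rewrite !big_cons evL IH.
Qed.

(** One direction is [joint_surjective]; conversely, evaluating a relation at elements with unit
    coordinates kills its coefficients. *)
Lemma free_joint_surjective (a b c : V) : free [:: c; a; b] <->
  forall i j k, exists g, [/\ ev a g = i, ev b g = j & ev c g = k].
Proof.
pose X := [tuple c; a; b]; split=> [/(@freeP _ _ _ X) fX i j k|surj].
  have evM l : forall x y, ev X`_l (x * y)%g = ev X`_l x + ev X`_l y.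
    by have /Z1P[] := evZ X`_l.
  have [|g gE] := joint_surjective (fun l => evM l) _
    (fun l : 'I_3 => [:: k; i; j]`_l).
    move=> m m0; apply: fX; apply: ev_eq0 => x.
    by rewrite (ev_sum m (fun i => X`_i)).
  by exists g; split; [exact: (gE (@Ordinal 3 1 isT))
    | exact: (gE (@Ordinal 3 2 isT)) | exact: (gE (@Ordinal 3 0 isT))].
apply/(@freeP _ _ _ X) => m /(congr1 ev) E.
have {}E i j k : m 0 * k + (m 1 * i + m 2 * j) = 0.
  have [g [<- <- <-]] := surj i j k; have := congr1 (fun f => f g) E.
  rewrite (ev_sum m (fun i => X`_i)) ev0 !big_ord_recl big_ord0 addr0 /= => <-.
  by congr (_ * _ + (m _ * _ + m _ * _)); apply: val_inj.
move=> i; have [->|[->|->]] : i = 0 \/ (i = 1 \/ i = 2).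
- case: i => [[|[|[|//]]] li]; [left|right; left|right; right]; exact: val_inj.
- by have := E 0 0 1; rewrite mulr1 !mulr0 !addr0.
- by have := E 1 0 0; rewrite mulr1 !mulr0 addr0 add0r.
- by have := E 0 1 0; rewrite mulr1 !mulr0 !add0r.
Qed.

(** Two primitives of the same [f] differ by a homomorphism. *)
Lemma primitive_torsor (f : G * G -> F) (s x : G -> F) :
  Cochain1 s -> (forall g1 g2, s (g1 * g2)%g = s g1 + s g2 + f (g1, g2)) ->
  Cochain1 x -> (forall g1 g2, x (g1 * g2)%g = x g1 + x g2 + f (g1, g2)) ->
  exists u, x = (fun g => s g + ev u g).
Proof.
move=> cs sM cx xM; have /ev_surj[u uE] : Z1 (fun g => x g - s g).
  apply/Z1P; split; first exact: (Cochain1_map2 (fun i j => i - j) cx cs).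
  by move=> g1 g2; rewrite xM sM; Fp_ring.
by exists u; rewrite -uE; apply/funext => g; rewrite addrC subrK.
Qed.

(** Chosen primitives of the cup products and Massey cocycles serve as base points. An epimorphism
    is then given uniquely by [a], [b], [c] and by translations [u], [v], [z] of its three upper
    entries, subject to the vanishing of the Massey class. *)
Lemma card_Epi : (0 < d)%N -> cup_nondegenerate p G ->
  finite_set (Epi G U) /\
  #|` fset_set (Epi G U)| = (massey_triples cup_form * p ^ (3 * d - 1))%N.
Proof.
move=> d_gt0 nd.
(* The vanishing condition stays under the existential so that [choice] yields a total function;
   zero is a placeholder when the cup product is nonzero. *)
have sEx (w : V * V) : exists s : G -> F, cup_form w.1 w.2 = 0 -> Cochain1 s /\
    forall x y, s (x * y)%g = s x + s y + cup (ev w.1) (ev w.2) (x, y).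
  have [w0|] := eqVneq (cup_form w.1 w.2) 0; last first.
    by move=> /eqP w0; exists (fun=> 0).
  have /hP/B2P[] // : h (cup (ev w.1) (ev w.2)) = 0 by [].
    exact: Z2_cup.
  by move=> s cs sM; exists s.
have {sEx} [s sP] := choice sEx.
pose X a b u g := s (a, b) g + ev u g.
have XC a b u : cup_form a b = 0 -> Cochain1 (X a b u).
  move=> /(sP (a, b))[cs _]; have /Z1P[cu _] := evZ u.
  exact: (Cochain1_map2 (fun i j => i + j) cs cu).
have XM a b u : cup_form a b = 0 ->
    forall x y, X a b u (x * y)%g =
      X a b u x + X a b u y + cup (ev a) (ev b) (x, y).
  move=> /(sP (a, b))[_ sM] x y; have /Z1P[_ uM] := evZ u.
  by rewrite /X sM uM /=; Fp_ring.
(* The class of this Massey cocycle obstructs the existence of a corner entry. *)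
pose m a b c u v x := cup (ev a) (X b c v) x + cup (X a b u) (ev c) x.
have mZ a b c u v : cup_form a b = 0 -> cup_form b c = 0 -> Z2 (m a b c u v).
  move=> ab0 bc0; apply: (@Z2_massey p G (ev a) (ev b) (ev c)) => //;
    by [exact: XC | exact: XM].
have tEx (w : V * (V * V) * (V * V)) : exists t : G -> F,
    let m' := m w.1.2.1 w.1.1 w.1.2.2 w.2.1 w.2.2 in
    cup_form w.1.2.1 w.1.1 = 0 -> cup_form w.1.1 w.1.2.2 = 0 -> h m' = 0 ->
    Cochain1 t /\ forall x y, t (x * y)%g = t x + t y + m' (x, y).
  move: w => [[b [a c]] [u v]] /=.
  have [[ab0 [bc0 m0]]|nw] := pselect (cup_form a b = 0 /\ (cup_form b c = 0 /\
    h (m a b c u v) = 0)); last by exists (fun=> 0) => *; case: nw.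
  by move/hP: m0 => /(_ (mZ _ _ _ _ _ ab0 bc0))/B2P[t ct tM]; exists t.
have {tEx} [t tP] := choice tEx.
pose Phi (w : V * (V * V) * (V * V * V)) g :=
  let: ((b, (a, c)), ((u, z), v)) := w in
  ut4 (ev a g) (ev b g) (ev c g) (X a b u g) (X b c v g)
    (t (b, (a, c), (u, v)) g + ev z g).
pose P : pred (V * (V * V)) := [pred x : V * (V * V) |
  [&& free [:: x.2.2; x.2.1; x.1],
       cup_form x.2.1 x.1 == 0 & cup_form x.1 x.2.2 == 0]].
pose Q x : pred (V * V * V) := [pred y : V * V * V |
  h (m x.2.1 x.1 x.2.2 y.1.1 y.2) == 0].
have ev_add_inj (f : G -> F) u v :
    (forall g, f g + ev u g = f g + ev v g) -> u = v.
  by move=> E; apply/ev_inj/funext => g; exact: addrI (E g).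
(* Entries are read in order: [a], [b], [c] fix the base points of the (1, 3) and (2, 4) entries,
   and with [u], [v] also that of the corner. *)
have PhiI : injective Phi.
  move=> [[b [a c]] [[u z] v]] [[b' [a' c']] [[u' z'] v']] E.
  have {}E g := ut4_inj (congr1 (fun f => f g) E).
  have ? : a = a' by apply/ev_inj/funext => g; case: (E g).
  have ? : b = b' by apply/ev_inj/funext => g; case: (E g) => _ [].
  have ? : c = c' by apply/ev_inj/funext => g; case: (E g) => _ [_ []].
  subst a' b' c'.
  have ? : u = u'.
    by apply: ev_add_inj => g; case: (E g) => _ [_ [_ [+ _]]]; exact.
  have ? : v = v'.
    by apply: ev_add_inj => g; case: (E g) => _ [_ [_ [_ [+ _]]]]; exact.
  subst u' v'.
  have -> // : z = z'.
  by apply: ev_add_inj => g; case: (E g) => _ [_ [_ [_ [_ +]]]]; exact.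
have EpiE : Epi G U = Phi @` [set w | P w.1 && Q w.1 w.2].
  apply/seteqP; split=> [f /Epi_ut4|_ [[[b [a c]] [[u z] v]] /= + <-]].
    move=> [a [b [c [x [y [z [-> [[Za Zb Zc] [cx cy cz] xM yM zM] surj]]]]]]].
    move: Za Zb Zc => /ev_surj[va ?] /ev_surj[vb ?] /ev_surj[vc ?]; subst a b c.
    have ab0 : cup_form va vb = 0.
      by apply/hP; [exact: Z2_cup | apply/B2P; exists x].
    have bc0 : cup_form vb vc = 0.
      by apply/hP; [exact: Z2_cup | apply/B2P; exists y].
    have [s1C s1M] := sP (va, vb) ab0; have [s2C s2M] := sP (vb, vc) bc0.
    have [u uE] := primitive_torsor s1C s1M cx xM.
    have [v vE] := primitive_torsor s2C s2M cy yM.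
    have m0 : h (m va vb vc u v) = 0.
      apply/hP; [exact: mZ | apply/B2P; exists z => // g1 g2].
      by rewrite zM uE vE.
    have [tC tM] := tP (vb, (va, vc), (u, v)) ab0 bc0 m0.
    have [w wE] : exists w, z = (fun g => t (vb, (va, vc), (u, v)) g + ev w g).
      by apply: (primitive_torsor tC tM cz) => g1 g2; rewrite zM uE vE.
    exists (vb, (va, vc), (u, w, v)); last by rewrite /Phi uE vE wE.
    rewrite /= /P /Q /= ab0 bc0 m0 eqxx !andbT.
    exact/free_joint_surjective.
  move=> /andP[/and3P[/= /free_joint_surjective surj /eqP ab0 /eqP bc0]].
  move=> /eqP /= m0.
  have [tC tM] := tP (b, (a, c), (u, v)) ab0 bc0 m0.
  apply: ut4_Epi => //; have /Z1P[zC zM] := evZ z; split=> //.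
  - by split; [exact: XC | exact: XC |];
      exact: (Cochain1_map2 (fun i j => i + j) tC zC).
  - exact: XM.
  - exact: XM.
  - by move=> g1 g2; rewrite tM zM /m /=; Fp_ring.
have [fin ->] := card_image_finpred (D := [pred w | P w.1 && Q w.1 w.2])
  (in2W PhiI) EpiE.
split=> //; rewrite card_dep_pair (eq_bigr (fun=> (p ^ (3 * d - 1))%N)).
  by rewrite sum_nat_const.
move=> [b [a c]] /and3P[/= fr /eqP ab0 /eqP bc0].
have a0 : a != 0.
  move: fr; rewrite free_cons => /andP[_]; rewrite free_cons => /andP[+ _].
  by apply: contraNneq => ->; exact: mem0v.
have [w aw] := cup_form_nondegenerate nd a0.
(* The obstruction is affine in [v], with nonzero linear part [cup_form a v]. *)
pose R (y : V * V) : pred V := [pred v | cup_form a v == - h (m a b c y.1 0)].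
have -> : #|Q (b, (a, c))| = (\sum_(y : V * V) #|R y|)%N.
  rewrite -(card_dep_pair predT R); apply: eq_card => -[[u z] v].
  rewrite !inE /Q /R /= ?inE /=.
  have -> : m a b c u v = fun x => 1 * cup (ev a) (ev v) x + m a b c u 0 x.
    by apply/funext => x; rewrite /m /X /cup ev0; Fp_ring.
  by rewrite hL ?mul1r ?addr_eq0 //; [exact: Z2_cup | exact: mZ].
(* [u] and [z] are free while [v] runs over an affine hyperplane, whence the exponent
   [2d + (d - 1)]. *)
rewrite (eq_bigr (fun=> (p ^ (d - 1))%N)) => [|y _].
  rewrite sum_nat_const card_prod card_rV card_Fp // -!expnD; congr (_ ^ _)%N.
  by lia.
rewrite (card_linear_fiber (w := w)) ?card_Fp // => k u v; exact: cup_form_linr.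
Qed.

End Count.

(** * Quotient groups, 2-adic integers, and maps vanishing on commutators *)

Section QuotientProjection.
Local Open Scope quotient_scope.
Variables (G : topGroupType) (N : normal_subgroup G).
Local Notation Q := (topgroup_quotient N).

Lemma topquot_pi_eq (x y : G) : \pi_Q x = \pi_Q y <-> (N : set G) (x^-1 * y)%g.
Proof. by split=> [/eqmodP/asboolP|/asboolP Nxy]; last exact/eqmodP. Qed.

Lemma topquot_piM (x y : G) : (\pi_Q x * \pi_Q y)%g = \pi_Q (x * y)%g :> Q.
Proof.
have piP z : (N : set G) (z^-1 * generic_quotient.repr (\pi_Q z))%g.
  by apply/topquot_pi_eq; rewrite reprK.
apply/esym/topquot_pi_eq.
set x' := generic_quotient.repr (\pi_Q x).
set y' := generic_quotient.repr (\pi_Q y).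
have -> : ((x * y)^-1 * (x' * y') = (x^-1 * x') ^ y * (y^-1 * y'))%g.
  by rewrite invgM conjgE !mulgA mulgK.
by apply: subgroupM; [apply: subgroupJ|]; exact: piP.
Qed.
End QuotientProjection.

Section PadicTwo.
Local Notation Z_2 := (padic_int 2).

(** Component [n] is the residue modulo [2 ^ n.+1]: index 0 means modulo 2 and index 1 modulo 4. *)
Definition padic_residue (n : nat) (x : Z_2) : 'Z_(2 ^ n.+1) := val x n.

Lemma padic_residueM n x y :
  padic_residue n (x * y)%g = padic_residue n x + padic_residue n y.
Proof. by []. Qed.

Lemma padic_residueX n x m :
  padic_residue n (x ^+ m)%g = padic_residue n x *+ m.
Proof.
by elim: m => [|m IH]; rewrite ?mulr0n // expgS padic_residueM IH mulrS.
Qed.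

Lemma padic_residue_continuous n :
  continuous (padic_residue n : Z_2 -> discrete_topology 'Z_(2 ^ n.+1)).
Proof.
move=> x; apply: (@continuous_comp _ _ _
  (val : Z_2 -> topgroup_prod (padic_factor 2)) (proj n)).
  exact: initial_continuous.
exact: (@proj_continuous nat (fun i => padic_factor 2 i : topologicalType) n).
Qed.

(** Even 2-adic integers are doubles; the group law is addition, so [y * y] is twice [y]. *)
Lemma padic_square (x : Z_2) : padic_residue 0 x = 0 -> exists y, x = (y * y)%g.
Proof.
move=> x0; pose X n : nat := padic_residue n x.
have Xmod n : (X n.+1 = X n %[mod 2 ^ n.+1])%N by have /set_mem/(_ n) := valP x.
have two_gt1 n : (1 < 2 ^ n.+1)%N by rewrite -[1%N]/(2 ^ 0)%N ltn_exp2l.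
have Xlt n : (X n < 2 ^ n.+1)%N.
  by rewrite -[X in (_ < X)%N](Zp_cast (two_gt1 n)); exact: ltn_ord.
have Xodd n : odd (X n) = false.
  elim: n => [|n IH]; first by rewrite /X x0.
  by rewrite -IH; have := congr1 odd (Xmod n); rewrite !odd_mod // oddX.
have X2 n : X n = (2 * (X n %/ 2))%N.
  by rewrite mulnC divnK // dvdn2 Xodd.
(* Halving loses one binary digit, so component [n] of [y] comes from component [n.+1] of [x]. *)
pose y : topgroup_prod (padic_factor 2) :=
  fun n => inZp (X n.+1 %/ 2)%N : 'Z_(2 ^ n.+1).
have yE n : (y n : 'Z_(2 ^ n.+1)) = ((X n.+1 %/ 2) %% 2 ^ n.+1)%N :> nat.
  by rewrite /= Zp_cast.
have yC : padic_compatible y.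
  move=> n; rewrite !yE modn_mod modn_dvdm ?dvdn_exp2l //.
  apply/eqP; rewrite -(eqn_pmul2l (isT : 0 < 2)%N) !muln_modr -expnS -!X2.
  exact/eqP.
exists (exist _ y (mem_set yC)); apply: val_inj.
apply: functional_extensionality_dep => n; apply: val_inj.
transitivity (X n) => //.
transitivity (((y n : 'Z_(2 ^ n.+1)) + (y n : 'Z_(2 ^ n.+1))) %% 2 ^ n.+1)%N.
  by rewrite yE modnDm addnn -mul2n -X2 Xmod modn_small.
by rewrite /= Zp_cast.
Qed.

Definition padic_one_fun : topgroup_prod (padic_factor 2) :=
  fun n => 1%R : 'Z_(2 ^ n.+1).

Lemma padic_one_compatible : padic_compatible padic_one_fun.
Proof. by move=> n. Qed.

Definition padic_one : Z_2 :=
  exist _ padic_one_fun (mem_set padic_one_compatible).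

End PadicTwo.

(** The common zeros of [a] and [c] form a closed subgroup, and it contains all commutators because
    the defect [k * (a x * a y)] is symmetric in [x] and [y]. *)
Lemma closed_commutator_primitive (p : nat) (G : topGroupType) (k : 'F_p)
    (a c : G -> 'F_p) (n : G) : Z1 a -> Cochain1 c ->
  (forall x y, c (x * y)%g = c x + c y + k * (a x * a y)) ->
  (closed_commutator G : set G) n -> a n = 0 /\ c n = 0.
Proof.
move=> /Z1P[ca aM] cc cM; pose K := [set x | a x = 0 /\ c x = 0].
have a1 : a 1%g = 0 by apply: (addrI (a 1%g)); rewrite -aM mul1g addr0.
have c1 : c 1%g = 0.
  apply: (addrI (c 1%g)).
  by rewrite addr0 -[in RHS](mul1g 1%g) cM a1 !mulr0 addr0.
have K1 : K 1%g by [].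
have KM x y : K x -> K y -> K (x * y)%g.
  by move=> [ax cx] [ay cy]; rewrite /K /= aM cM ax ay cx cy !mulr0 !addr0.
have KV x : K x -> K x^-1%g.
  move=> [ax cx]; split.
    by have := aM x x^-1%g; rewrite mulgV a1 ax add0r.
  by have := cM x x^-1%g; rewrite mulgV c1 ax cx mul0r mulr0 add0r addr0.
move=> /(_ (Subgroup K1 KM KV)); apply.
  have -> : (Subgroup K1 KM KV : set G) =
      ((a : G -> discrete_topology 'F_p) @^-1` [set 0]) `&`
      ((c : G -> discrete_topology 'F_p) @^-1` [set 0]) by [].
  by apply: closedI; apply: closed_comp => [x _|]; (exact: ca || exact: cc ||
    exact: discrete_closed).
move=> y z; have yzE : (y * z = z * y * [~ y, z])%g.
  by rewrite commgEl conjgE -mulgA !mulKVg.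
have a0 : a [~ y, z]%g = 0.
  by apply: (addrI (a (z * y)%g)); rewrite -aM -yzE !aM addr0 addrC.
split=> //; apply: (addrI (c (z * y)%g)).
have := cM (z * y)%g [~ y, z]%g; rewrite -yzE a0 !mulr0 !addr0 => <-.
by rewrite !cM [a z * a y]mulrC [c z + c y]addrC.
Qed.

Lemma continuous_discrete_comp (T : topologicalType) (X Y : choiceType)
    (f : T -> X) (h : X -> Y) :
  continuous (f : T -> discrete_topology X) ->
  continuous ((h \o f) : T -> discrete_topology Y).
Proof.
move=> /continuous_discreteP cf; apply/continuous_discreteP => x.
by apply: filterS (cf x) => y /= ->.
Qed.
Arguments continuous_discrete_comp {T X Y f} h.

(* The cup square of a homomorphism to Z/2 is its Bockstein, the obstruction to
   lifting it to Z/4. *)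
Lemma B2_cup_self_lift (G : topGroupType) (L : G -> 'Z_4) :
  continuous (L : G -> discrete_topology 'Z_4) ->
  (forall x y, L (x * y)%g = L x + L y) ->
  let a g := (L g : nat)%:R : 'F_2 in Z1 a /\ B2 (cup a a).
Proof.
move=> cL LM a; have Za : Z1 a.
  apply/Z1P; split.
    exact: (continuous_discrete_comp
      (fun u : 'Z_4 => (u : nat)%:R : 'F_2) cL).
  move=> x y; rewrite /a LM.
  by case: (L x) (L y) => [[|[|[|[|//]]]] ?] [[|[|[|[|//]]]] ?]; apply/eqP.
(* The primitive is the high binary digit of [L]: in addition modulo 4, the carry into it is
   [a x * a y]. *)
split=> //; apply/B2P; exists (fun g => ((L g : nat) %/ 2)%:R).
  exact: (continuous_discrete_comp
    (fun u : 'Z_4 => ((u : nat) %/ 2)%:R : 'F_2) cL).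
move=> x y; rewrite /cup /a LM /=.
by case: (L x) (L y) => [[|[|[|[|//]]]] ?] [[|[|[|[|//]]]] ?]; apply/eqP.
Qed.

(** * The q-invariant and cup squares for p = 2 *)

Section QInvariantTwo.
Local Open Scope quotient_scope.
Variables (G : topGroupType) (d q : nat).
Local Notation F := 'F_2.
Local Notation N := (closed_commutator G).
Local Notation P :=
  (topgroup_prod (fun _ : 'I_d.-1 => padic_int 2 : topGroupType)).
Local Notation Zq := (topgroup_quotient (padic_multiple 2 q)).
Local Notation A := (P * Zq)%type.

Lemma abelianization_map :
  topgroup_iso (topgroup_quotient N) A ->
  exists phi : G -> A, [/\ {morph phi : x y / (x * y)%g}, continuous phi,
    forall y, exists x, phi x = y & forall x, phi x = 1%g -> (N : set G) x].
Proof.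
move=> [f [g [fK gK fM fC _]]]; exists (f \o \pi_(topgroup_quotient N)); split.
- by move=> x y /=; rewrite -fM topquot_piM.
- by move=> x; apply: continuous_comp; [exact: pi_continuous | exact: fC].
- by move=> y; exists (generic_quotient.repr (g y)); rewrite /= reprK.
- move=> x /= fx; have f1 : f 1%g = 1%g.
    by apply: (mulgI (f 1%g)); rewrite -fM !mulg1.
  have : \pi_(topgroup_quotient N) 1%g = \pi_(topgroup_quotient N) x.
    by apply: (can_inj fK); rewrite fx; exact: f1.
  by move=> /topquot_pi_eq; rewrite invg1 mul1g.
Qed.

(** Multiples of [q] vanish modulo [2 ^ n.+1], so the residue descends to the quotient; [q = 0] is
    included. *)
Lemma padic_residue_eq_mod n (x y : padic_int 2) : (2 ^ n.+1 %| q)%N ->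
  \pi_Zq x = \pi_Zq y -> padic_residue n x = padic_residue n y.
Proof.
move=> nq /topquot_pi_eq[z _ zE]; have := congr1 (padic_residue n) zE.
have two_gt1 : (1 < 2 ^ n.+1)%N by rewrite -[1%N]/(2 ^ 0)%N ltn_exp2l.
rewrite padic_residueX -mulr_natr -(divnK nq) natrM pchar_Zp // !mulr0.
rewrite padic_residueM => E; apply: (addrI (padic_residue n x^-1%g)).
by rewrite -E -padic_residueM mulVg.
Qed.

Lemma padic_residue_repr_continuous n : (2 ^ n.+1 %| q)%N ->
  continuous ((fun u : Zq => padic_residue n (generic_quotient.repr u))
    : Zq -> discrete_topology 'Z_(2 ^ n.+1)).
Proof.
move=> nq; apply/quotient_continuous => x.
have -> : ((fun u : Zq => padic_residue n (generic_quotient.repr u)) \o \pi_Zq)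
    = padic_residue n.
  by apply/funext => y; apply: padic_residue_eq_mod; rewrite ?reprK.
exact: padic_residue_continuous.
Qed.

Lemma padic_residue_reprM n (u v : Zq) : (2 ^ n.+1 %| q)%N ->
  padic_residue n (generic_quotient.repr (u * v)%g) =
  padic_residue n (generic_quotient.repr u)
    + padic_residue n (generic_quotient.repr v).
Proof.
move=> nq; rewrite -padic_residueM; apply: padic_residue_eq_mod => //.
by rewrite -topquot_piM !reprK.
Qed.

Lemma padic_residue_repr n (x : padic_int 2) : (2 ^ n.+1 %| q)%N ->
  padic_residue n (generic_quotient.repr (\pi_Zq x)) = padic_residue n x.
Proof. by move=> nq; apply: padic_residue_eq_mod; rewrite ?reprK. Qed.

Hypothesis iso : topgroup_iso (topgroup_quotient N) A.

(** ['Z_2] and ['F_2] are convertible, so residues modulo 2 can serve as cocycles. *)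
Lemma Z1_two (a : G -> 'Z_2) : continuous (a : G -> discrete_topology 'Z_2) ->
  (forall x y, a (x * y)%g = a x + a y) -> @Z1 2 G a.
Proof. by move=> ca aM; apply/Z1P. Qed.

(* If [g] generates the Z/2 factor, a lift to Z/4 of its coordinate would be
   odd at [g] but vanish at [g * g], which lies in the closed commutator. *)
Lemma cup_self_nontrivial : q = 2%N ->
  ~ (forall a : G -> F, Z1 a -> B2 (cup a a)).
Proof.
move=> q2 alt; have [phi [phiM phiC phiS phiN]] := abelianization_map iso.
have q_even : (2 ^ 1 %| q)%N by rewrite q2.
pose a g : F := padic_residue 0 (generic_quotient.repr (phi g).2).
have Za : Z1 a.
  apply: Z1_two => [x|x y]; last by rewrite /a phiM padic_residue_reprM.
  apply: (@continuous_comp _ _ (discrete_topology 'Z_(2 ^ 1)) (snd \o phi)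
    (fun u : Zq => padic_residue 0 (generic_quotient.repr u))).
    by apply: continuous_comp; [exact: phiC | exact: cvg_snd].
  exact: padic_residue_repr_continuous.
have /B2P[c cc cM] := alt a Za.
have [g gE] := phiS (1%g, \pi_Zq padic_one).
have ag : a g = 1 by rewrite /a gE /= padic_residue_repr.
have /(closed_commutator_primitive (k := 1) Za cc)[|_] : (N : set G) (g * g)%g.
- apply: phiN; rewrite phiM gE; congr (_, _) => /=; first exact: mulg1.
  have -> : (\pi_Zq padic_one * \pi_Zq padic_one)%g
      = \pi_Zq (padic_one * padic_one)%g :> Zq.
    exact: topquot_piM.
  apply/esym/topquot_pi_eq; exists padic_one => //.
  by rewrite invg1 mul1g q2.
- by move=> x y; rewrite cM mul1r.
(* [c (g * g)] is twice [c g] plus 1, that is 1, yet it must vanish. *)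
rewrite cM /cup /= ag mul1r.
have -> : c g + c g = 0 by case: (c g) => [[|[|//]] ?]; apply/eqP.
by rewrite add0r.
Qed.

Variable ev : 'rV[F]_d -> G -> F.
Hypothesis evZ : forall v, Z1 (ev v).
Hypothesis evL : forall k u v, ev (k *: u + v) = (fun x => k * ev u x + ev v x).
Hypothesis ev_surj : forall a, Z1 a -> exists v, a = ev v.
Hypothesis ev_eq0 : forall v, (forall x, ev v x = 0) -> v = 0.
Hypothesis d_gt0 : (0 < d)%N.

Lemma q_invariant_neq1 : q <> 1%N.
Proof.
(* Otherwise G / [G, G] is Z_2^(d-1), whose homomorphisms to Z/2 form a space of
   dimension d - 1 < d. *)
move=> q1; have [phi [phiM phiC phiS phiN]] := abelianization_map iso.
have evM v := proj2 ((Z1P _).1 (evZ v)).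
have ev_basis (k : 'I_d -> F) :
    (forall x, \sum_i k i * ev (delta_mx 0 i) x = 0) -> forall i, k i = 0.
  move=> k0 i; have : \sum_i k i *: delta_mx 0 i = 0 :> 'rV[F]_d.
    by apply: ev_eq0 => x; rewrite (ev_sum evL).
  have -> : \sum_i k i *: delta_mx 0 i = \row_i k i :> 'rV[F]_d.
    by rewrite [RHS]row_sum_delta; apply: eq_bigr => j _; rewrite mxE.
  by move=> /rowP/(_ i); rewrite !mxE.
have surj (r : {ffun 'I_d -> F}) :
    exists g, forall i, ev (delta_mx 0 i) g = r i.
  exact: (joint_surjective (fun i => evM (delta_mx 0 i)) ev_basis r).
have [gr grE] := choice surj.
(* If [D] is injective, [2 ^ d] value vectors embed into [2 ^ d.-1] residue vectors, which is
   absurd. *)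
pose D r : {ffun 'I_d.-1 -> 'Z_2} :=
  [ffun j => padic_residue 0 ((phi (gr r)).1 j)].
have DI : injective D.
  move=> r r' /ffunP E.
  have Zq1 (u : Zq) : u = 1%g.
    elim/quotW: u => z; apply/esym/topquot_pi_eq.
    by exists z => //; rewrite invg1 mul1g q1.
  have half j : exists y, (phi (gr r')).1 j = (y * y * (phi (gr r)).1 j)%g.
    have [|y yE] := @padic_square ((phi (gr r')).1 j * ((phi (gr r)).1 j)^-1)%g.
      rewrite padic_residueM; have := E j; rewrite !ffunE => <-.
      by rewrite -padic_residueM mulgV.
    by exists y; rewrite -yE mulgKV.
  have [y yE] := choice half.
  (* Modulo the closed commutator, [gr r'] is [k * k * gr r]; homomorphisms to F_2 do not see
     [k * k], so [r] and [r'] agree. *)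
  have [k kE] := phiS (y, 1%g).
  have : (N : set G) (gr r' * (k * k * gr r)^-1)%g.
    apply: phiN; apply: (mulIg (phi (k * k * gr r)%g)).
    rewrite -phiM mulgKV mul1g !phiM kE.
    rewrite [LHS]surjective_pairing [RHS]surjective_pairing; congr (_, _).
      by apply: functional_extensionality_dep => j; exact: yE.
    by rewrite [LHS]Zq1 [RHS]Zq1.
  have ZC0 : @Cochain1 2 G (fun=> 0) by apply/Cochain1P => x; exact: filterE.
  move=> Nx; apply/ffunP => i.
  have [|+ _] := closed_commutator_primitive (k := 0) (evZ (delta_mx 0 i))
    ZC0 _ Nx.
    by move=> x z; rewrite mul0r !addr0.
  move=> /(congr1 (fun u => u + ev (delta_mx 0 i) (k * k * gr r)%g)).
  rewrite -evM mulgKV add0r !evM !grE => ->.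
  set u := ev _ k.
  have -> : u + u = 0 by case: u => [[|[|//]] ?]; apply/eqP.
  by rewrite add0r.
have := leq_card D DI; rewrite !card_ffun !card_ord.
by rewrite leq_exp2l // -ltnS prednK // ltnn.
Qed.

(** When 4 divides [q], each of the [d] factors of the abelianization maps onto Z/4. The reductions
    modulo 2 form a basis of H^1 made of classes that lift to Z/4, hence have trivial cup square. *)
Lemma cup_self_trivial : (4 %| q)%N -> forall a : G -> F, Z1 a -> B2 (cup a a).
Proof.
move=> q4; have [phi [phiM phiC phiS phiN]] := abelianization_map iso.
(* [Some i] indexes the free factors and [None] the factor [Zq], giving [d] indices in all. *)
pose I : finType := option 'I_d.-1.
pose L (o : I) g : 'Z_4 := if o is Some i then padic_residue 1 ((phi g).1 i)
  else padic_residue 1 (generic_quotient.repr (phi g).2).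
have LC o : continuous (L o : G -> discrete_topology 'Z_4).
  case: o => [i|] x.
    apply: (@continuous_comp _ _ (discrete_topology 'Z_(2 ^ 2))
      (fun g => (phi g).1 i) (padic_residue 1)); last first.
      exact: padic_residue_continuous.
    apply: (@continuous_comp _ _ _ (fst \o phi) (fun u : P => u i)).
      by apply: continuous_comp; [exact: phiC | exact: cvg_fst].
    exact: (@proj_continuous _
      (fun _ : 'I_d.-1 => padic_int 2 : topologicalType) i).
  apply: (@continuous_comp _ _ (discrete_topology 'Z_(2 ^ 2)) (snd \o phi)
    (fun u : Zq => padic_residue 1 (generic_quotient.repr u))).
    by apply: continuous_comp; [exact: phiC | exact: cvg_snd].
  exact: padic_residue_repr_continuous.
have LM o x y : L o (x * y)%g = L o x + L o y.
  by case: o => [i|]; rewrite /L phiM // padic_residue_reprM.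
pose a o g : F := (L o g : nat)%:R.
have aP o : Z1 (a o) /\ B2 (cup (a o) (a o)) by exact: B2_cup_self_lift.
have [v vE] := choice (fun o => ev_surj (aP o).1).
(* Elements of [G] dual to the [a o] prove their independence. *)
have dual o : exists g, forall o', a o' g = (o' == o)%:R.
  case: o => [i|].
    pose u : P := fun j => if j == i then padic_one else 1%g.
    have [g gE] := phiS (u, \pi_Zq 1%g); exists g => -[j|]; rewrite /a /L gE /=.
      by rewrite /u (inj_eq Some_inj); case: eqP.
    by rewrite padic_residue_repr.
  have [g gE] := phiS (1%g, \pi_Zq padic_one).
  exists g => -[j|]; rewrite /a /L gE //=.
  by rewrite padic_residue_repr.
pose X := codom_tuple v.
have XE (i : 'I_#|I|) : X`_i = v (enum_val i) by exact: nth_codom.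
have freeX : free X.
  apply/freeP => k k0 i; have [g gE] := dual (enum_val i).
  have := congr1 (fun w => ev w g) k0.
  rewrite (ev_sum evL) (ev0 evL) (bigD1 i) //= XE -vE gE eqxx mulr1.
  rewrite big1 ?addr0 // => j ji; rewrite XE -vE gE.
  by rewrite (inj_eq enum_val_inj) (negPf ji) mulr0.
have fullX : <<X>>%VS = fullv.
  apply/eqP; rewrite eqEdim subvf dimvf /= (eqP freeX) size_tuple.
  by rewrite card_option card_ord prednK // dim_matrix mul1r.
move=> b /ev_surj[w ->]; have : w \in <<X>>%VS by rewrite fullX memvf.
move=> /coord_span ->; elim/big_rec: _ => [|i u _ IH].
  by apply/B2P; exists (fun=> 0); [apply/Cochain1P => x; exact: filterE |
    move=> x y; rewrite /cup !(ev0 evL) mulr0 !addr0].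
rewrite evL; apply: B2_cup_self_lin => //.
by rewrite XE -vE; case: (aP (enum_val i)).
Qed.
End QInvariantTwo.

(** * The two cases of the formula *)

Local Open Scope classical_set_scope.
Local Open Scope fset_scope.
Local Open Scope ring_scope.

Theorem theorem3p7 (p : nat) (p_pr : prime p) (G : topGroupType) (d q : nat)
    (G_demushkin : demushkin p G) (G_rank : dimH1 p G d) (d_ge1 : (1 <= d)%N)
    (G_q : is_q_invariant p G d q) :
  finite_set (Epi G (unitriangular_group 4 p)) /\
  (#|` fset_set (Epi G (unitriangular_group 4 p))|)%:Z =
    if q != 2%N then
      (p%:Z ^+ d - 1) * (p%:Z ^+ (d - 1) - p%:Z) * (p%:Z ^+ (d - 1) - p%:Z ^+ 2)
        * p%:Z ^+ (3 * d - 1)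
    else
      (2 ^+ (d - 1) - 1) * (2 ^+ (d - 1) - 2) * (2 ^+ d - 4) * 2 ^+ (3 * d - 1).
Proof.
have [_ _ H2 nd] := G_demushkin; have [q_pow iso] := G_q.
have [h [hP hL]] := dimH2_functional H2.
have [ev [evZ evL ev_surj ev_eq0]] := dimH1_coordinates G_rank.
have [fin ->] := card_Epi p_pr hP hL evZ evL ev_surj ev_eq0 d_ge1 nd.
split=> //; set B := cup_form h ev.
have Bl := cup_form_linl hL evZ evL; have Br := cup_form_linr hL evZ evL.
have Bac := cup_form_anticomm hP hL evZ.
have Bsym := cup_form_sym0 hP hL evZ.
have Bnd := cup_form_nondegenerate hP evZ ev_surj ev_eq0 nd.
have B0P v : B v v = 0 <-> B2 (cup (ev v) (ev v)) by apply: hP; exact: Z2_cup.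
rewrite PoszM -!natz natrX; case: ifPn => [q_neq2|/negPn/eqP q2].
  rewrite massey_triples_alternating ?card_Fp // => v; apply/B0P.
  have [p2|p_neq2] := eqVneq p 2%N; last exact: B2_cup_self_odd.
  subst p; apply: (cup_self_trivial iso evZ evL ev_surj) => //.
  have q_neq1 := q_invariant_neq1 iso evZ evL ev_eq0 d_ge1.
  (* Zero and the powers of 2 other than 1 and 2 are all divisible by 4. *)
  case: q_pow q_neq1 q_neq2 => [->|[[|[|k]] ->]] //.
  by rewrite -[4%N]/(2 ^ 2)%N dvdn_exp2l.
have p2 : p = 2%N.
  case: q_pow => [|[k]]; rewrite q2 // => pk.
  have : (p %| 2)%N by case: k pk => // k ->; rewrite expnS dvdn_mulr.
  by rewrite dvdn_prime2 // => /eqP.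
subst p.
have [w Bw] : exists w, B w w != 0.
  apply: contrapT => /forallNP B0; apply: (cup_self_nontrivial iso q2) => a.
  by move=> /ev_surj[v ->]; apply/B0P/eqP/negPn/negP/B0.
rewrite (massey_triples_nonalternating Br Bsym Bnd d_ge1 (w := w)) //;
  last first.
  (* The diagonal is linear over F_2: the cross terms cancel by anticommutativity, and
     [k * k = k]. *)
  move=> k u v; rewrite Bl !Br mulrDr mulrA.
  have -> : k * k = k by case: k => [[|[|//]] ?]; apply/eqP.
  by rewrite -addrA [k * cup_form h ev u v + _]addrA -mulrDr Bac mulr0 add0r.
rewrite card_Fp // -[in 2%:R ^+ d](subnK d_ge1) exprD expr1.
(* With [t] for [2 ^ (d - 1)], the two summands [(t - 1)(t - 2)(t - 4)] and [t(t - 1)(t - 2)] add up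
   to [(t - 1)(t - 2)(2t - 4)]. *)
congr (_ * _); move: (2%:R ^+ (d - 1)) => t; lia.
Qed.
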